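(* Let $K$ be a field of characteristic zero, let $I\subset R=K[x_1,x_2,\ldots,x_n]$ be a graded Artinian ideal whose quotient ring $R/I$ has the $n$-SLP, and let $h$ be the Hilbert function of $R/I$. Suppose that the $k$-th difference $\Delta^k h$ is quasi-symmetric for every integer $k$ with $0\le k\le n-4$. Then the generic initial ideal $\operatorname{gin}(I)$ with respect to the graded reverse lexicographic order is the unique almost revlex ideal $J\subset R$ such that $R/J$ has Hilbert function $h$. In particular, $\operatorname{gin}(I)$ is determined only by the Hilbert function.
   Context: $R=K[x_1,\ldots,x_n]$ has the standard grading. A graded (homogeneous) ideal $I$ is Artinian if $\dim_K R/I<\infty$. The Hilbert function of $A=R/I$ is $t\mapsto\dim_K A_t$, identified with a finite sequence $(h_0,\ldots,h_c)$ (trailing zeros omitted, $h_j=0$ for $j>c$ and $j<0$). SLP: for a graded Artinian $K$-algebra $A=\bigoplus_i A_i$ and $\ell\in A_1$, $(A,\ell)$ has the SLP if for all $i\ge0$, $s>0$ the map $\times\ell^s:A_i\to A_{i+s}$ has full rank (is injective or surjective). $k$-SLP: $A$ has the $k$-SLP if there exist $g_1,\ldots,g_k\in A_1$ such that $(A,g_1)$ has the SLP and $(A/(g_1,\ldots,g_{i-1}),g_i)$ has the SLP for all $i=2,\ldots,k$. Difference: $(\Delta h)_i=\max\{h_i-h_{i-1},0\}$ for $i\ge 0$ with $h_{-1}=0$; $\Delta^k$ is $\Delta$ applied $k$ times and $\Delta^0h=h$. Unimodal: there is $i\ge 0$ with $h_0<h_1<\cdots<h_i$ and $h_i\ge h_{i+1}\ge\cdots$.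 Quasi-symmetric: a unimodal sequence $(h_0,\ldots,h_c)$ of positive integers such that, if $h_i$ is the maximum of $\{h_0,\ldots,h_c\}$, then every $h_j$ with $j>i$ ($j\le c$) equals one of $h_0,h_1,\ldots,h_i$. Graded reverse lexicographic order $>_{\text{revlex}}$ (with $x_1>\cdots>x_n$): $x^a>_{\text{revlex}}x^b$ if $\deg x^a>\deg x^b$, or the degrees are equal and the last nonzero entry of $a-b$ is negative. Generic initial ideal: for $g=(g_{ij})\in GL(n;K)$ let $g$ act on $R$ by $gx_j=\sum_i g_{ij}x_i$. There is a nonempty Zariski open $U\subset GL(n;K)$ such that the revlex initial ideals of $g(I)$ coincide for all $g\in U$; this common initial ideal is $\operatorname{gin}(I)$. Almost revlex ideal: a monomial ideal $J$ such that for each monomial $u$ in the minimal generating set of $J$, every monomial $v$ with $\deg v=\deg u$ and $v>_{\text{revlex}}u$ belongs to $J$. *)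

(* Defs.v *)
(* {mpoly K[n]} is K[x_1, ..., x_n], with x_(i+1) written 'X_i for i : 'I_n. *)
From mathcomp Require Import all_boot all_order all_algebra.
From mathcomp.multinomials Require Import mpoly.

Set Implicit Arguments.
Unset Strict Implicit.
Unset Printing Implicit Defensive.

Import GRing.Theory.
Local Open Scope ring_scope.

(* Subsets of the polynomial ring are Prop-valued predicates.  The quotient R/I
   is represented by polynomials modulo membership of differences in I. *)
Section Ideals.
Context (n : nat) (K : fieldType).
Local Notation R := {mpoly K[n]}.
Implicit Types (I J S : R -> Prop) (p q f : R).

Definition same_set I J : Prop := forall p, I p <-> J p.

(* The unit ideal is allowed. *)
Definition is_ideal I : Prop :=
  [/\ I 0, (forall p q, I p -> I q -> I (p + q)) & (forall f p, I p -> I (f * p))].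

Definition ideal_gen S : R -> Prop :=
  fun p => forall J, is_ideal J -> (forall q, S q -> J q) -> J p.

Definition graded_ideal I : Prop :=
  is_ideal I /\ forall p d, I p -> I (pihomog mdeg d p).

(* dim_K R/I is finite: finitely many classes span R/I. *)
Definition artinian I : Prop :=
  exists (d : nat) (b : 'I_d -> R),
    forall p, exists c : 'I_d -> K, I (p - \sum_(i < d) c i *: b i).

(* dim_K (R/I)_t = d: the classes of some b_1, ..., b_d in R_t form a basis of
   R_t / (I cap R_t). *)
Definition dim_component I (t d : nat) : Prop :=
  exists b : 'I_d -> R,
    [/\ (forall i, b i \is t.-homog),
        (forall c : 'I_d -> K,
            I (\sum_(i < d) c i *: b i) -> forall i, c i = 0)
      & (forall p, p \is t.-homog ->
            exists c : 'I_d -> K, I (p - \sum_(i < d) c i *: b i))].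

Definition hilbert_function I (h : nat -> nat) : Prop :=
  forall t, dim_component I t (h t).

(* Multiplication by the class of l ^+ s from (R/I)_i to (R/I)_(i+s). *)
Definition mult_injective I (l : R) (i s : nat) : Prop :=
  forall p, p \is i.-homog -> I (l ^+ s * p) -> I p.

Definition mult_surjective I (l : R) (i s : nat) : Prop :=
  forall q, q \is (i + s).-homog ->
    exists2 p, p \is i.-homog & I (q - l ^+ s * p).

Definition SLP I (l : R) : Prop :=
  forall i s : nat, (0 < s)%N -> mult_injective I l i s \/ mult_surjective I l i s.

(* The quotient of R/I by (g_0, ..., g_(i-1)) is R/(I + (g_0, ..., g_(i-1)));
   for i = 0 this is R/I itself. *)
Definition kSLP (k : nat) I : Prop :=
  exists g : 'I_k -> R,
    (forall i : 'I_k, g i \is 1.-homog) /\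
    (forall i : 'I_k,
       SLP (ideal_gen (fun p => I p \/ exists2 j : 'I_k, (j < i)%N & p = g j))
           (g i)).

End Ideals.

Arguments artinian {n K} I.
Arguments kSLP {n K} k I.

(* Finite sequences (h_0, ..., h_c) are identified with their extension by 0 to
   nat -> nat; truncated subtraction is max {_ - _, 0}. *)
Definition Delta (h : nat -> nat) : nat -> nat :=
  fun i => if i is j.+1 then (h i - h j)%N else h 0%N.

Definition unimodal (h : nat -> nat) : Prop :=
  exists i : nat, (forall j, (j < i)%N -> (h j < h j.+1)%N) /\
                  (forall j, (i <= j)%N -> (h j.+1 <= h j)%N).

Definition quasi_symmetric (h : nat -> nat) : Prop :=
  exists c : nat,
    [/\ (forall j, (j <= c)%N -> (0 < h j)%N),
        (forall j, (c < j)%N -> h j = 0%N),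
        unimodal h
      & (forall i, (i <= c)%N -> (forall j, (j <= c)%N -> (h j <= h i)%N) ->
           forall j, (i < j <= c)%N -> exists2 l, (l <= i)%N & h j = h l)].

(* The order instance that multinomials puts on 'X_{1..n} is degree-lexicographic
   (despite its documentation), hence this definition.  The index i is that of
   the last nonzero entry of a - b. *)
Definition revlex_gt (n : nat) (a b : 'X_{1..n}) : bool :=
  (mdeg b < mdeg a)%N ||
  (mdeg a == mdeg b) &&
    [exists i : 'I_n, (a i < b i)%N && [forall j : 'I_n, (i < j)%N ==> (a j == b j)]].

Section Gin.
Context (n : nat) (K : fieldType).
Local Notation R := {mpoly K[n]}.
Implicit Types (I J : R -> Prop) (p q f : R) (g : 'M[K]_n) (m u v : 'X_{1..n}).

Definition is_initial_monomial f m : Prop :=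
  m \in msupp f /\ forall m', m' \in msupp f -> m' != m -> revlex_gt m m'.

Definition initial_ideal I : R -> Prop :=
  ideal_gen (fun p => exists f m, [/\ I f, is_initial_monomial f m & p = 'X_[m]]).

(* g x_j = \sum_i g_ij x_i *)
Definition mx_act g p : R := p \mPo [tuple \sum_(i < n) g i j *: 'X_i | j < n].

Definition mx_act_ideal g I : R -> Prop := fun q => exists2 p, I p & q = mx_act g p.

(* Zariski open subsets of GL(n;K), as a subspace of affine n^2-space: the
   complement in GL(n;K) of the common zeros of a family F of polynomials in the
   matrix entries. *)
Definition zariski_open_GL (U : 'M[K]_n -> Prop) : Prop :=
  exists F : {mpoly K[n * n]} -> Prop,
    forall g, U g <-> g \in unitmx /\ exists2 f, F f & f.@[fun k => mxvec g 0 k] != 0.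

Definition is_gin_open I (U : 'M[K]_n -> Prop) : Prop :=
  [/\ zariski_open_GL U,
      (exists g, U g)
    & (forall g g', U g -> U g' ->
         same_set (initial_ideal (mx_act_ideal g I)) (initial_ideal (mx_act_ideal g' I)))].

(* The common initial ideal of the g(I), g in U.  Over an infinite field two
   nonempty open sets meet, so that the choice of U is immaterial.  Were there no
   such U, this would be the empty set, which is not an ideal. *)
Definition gin I : R -> Prop :=
  fun p => exists2 U, is_gin_open I U &
                      forall g, U g -> initial_ideal (mx_act_ideal g I) p.

Definition monomial_ideal J : Prop :=
  exists S : 'X_{1..n} -> Prop,
    same_set J (ideal_gen (fun p => exists2 m, S m & p = 'X_[m])).

(* The minimal generating set of a monomial ideal consists of its monomials that
   are minimal for divisibility. *)
Definition minimal_generator J u : Prop :=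
  J 'X_[u] /\ forall m, J 'X_[m] -> (m <= u)%MM -> m = u.

Definition almost_revlex J : Prop :=
  monomial_ideal J /\
  forall u v, minimal_generator J u -> mdeg v = mdeg u -> revlex_gt v u -> J 'X_[v].

End Gin.

(* Main.v *)
(* For a matrix [g] write [L = g(I)] and call a monomial standard if it is not a leading
   monomial of [L].  A set [C] of monomials of degree [t] that is closed under larger
   monomials has at least [r] leading monomials as soon as [r] elements of [L] have
   linearly independent coefficient vectors on [C], and this is an open condition on [g].
   Since revlex compares the exponents of the last variables first, the sets of monomials
   in the variables [x_0 ... x_k] with exponent of [x_k] less than [s] are of this form;
   for them the strong Lefschetz property provides enough independent elements, and for
   generic [g] the number of their standard monomials of degree [t] is [hdiff h_k s t],
   where [h_k] is the difference of [h] of order [n - k - 1].  So multiplication by powers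
   of [x_k] is injective or surjective on standard monomials in [x_0 ... x_k].

   This forces the initial ideal to be almost revlex, level by level: at levels [k >= 3]
   by quasi-symmetry, at level [k = 2] because in addition the initial ideal is stable
   under [x_1 -> x_0] for monomials in three variables, which holds after a generic shear
   [x_1 -> x_1 + a x_0] by a Wronskian argument in characteristic zero.

   Almost revlex ideals with the same Hilbert function coincide, by induction on the
   degree.  Hence the initial ideal is constant on the open set, and equals the generic
   initial ideal. *)
Require Import Defs.
From mathcomp Require Import all_boot all_order all_algebra all_fingroup.
From mathcomp.multinomials Require Import mpoly.
From mathcomp Require Import zify ring.
From Stdlib Require Import Classical ClassicalEpsilon.

Set Implicit Arguments.
Unset Strict Implicit.
Unset Printing Implicit Defensive.

(** * Counting monomials *)

Section Monomials.
Context (n : nat).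
Implicit Types (m u v : 'X_{1..n}) (P Q : pred 'X_{1..n}).

(** The rank conditions bound the number of standard monomials only from above. The bounds are
    nevertheless attained: [h] fixes the total in each degree, and division by [x_k ^ s] shows that
    the standard monomials divisible by it are at most as many as those [s] degrees lower. The
    Lefschetz forms are used up from the last variable downwards, so level [k] involves the
    difference of order [n - k - 1]. Differences of order at most [n - 4] thus reach down to level
    3, and level 2 needs its own argument. There the monomials of degree [T] in [x_0, x_1, x_2] with
    a given exponent of [x_2] form a chain, and the number [r] of leading ones among them depends on
    [h] alone. Hence the demand that the [r] largest be leading can be stated without reference to
    coordinates. Different chains may use different shears: each yields a nonempty open set, and
    finitely many of these meet over an infinite field. Finitely many conditions suffice because [I]
    contains all forms of large degree. *)

Definition mons (t : nat) : seq 'X_{1..n} :=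
  [seq m <- map (@bmnm n t.+1) (enum {: 'X_{1..n < t.+1}}) | mdeg m == t].

Lemma mem_mons t m : (m \in mons t) = (mdeg m == t).
Proof.
rewrite mem_filter andb_idr // => /eqP mt.
have lt : (mdeg m < t.+1)%N by rewrite mt.
by apply/mapP; exists (BMultinom lt); rewrite ?mem_enum.
Qed.

Lemma uniq_mons t : uniq (mons t).
Proof.
by apply: filter_uniq; rewrite map_inj_uniq; [rewrite enum_uniq | apply: val_inj].
Qed.

Lemma mem_filter_mons P t m : (m \in filter P (mons t)) = P m && (mdeg m == t).
Proof. by rewrite (mem_filter P) mem_mons. Qed.

Definition cnt t P := count P (mons t).

Lemma eq_cnt t P Q : (forall m, mdeg m = t -> P m = Q m) -> cnt t P = cnt t Q.
Proof. by move=> PQ; apply: eq_in_count => m; rewrite mem_mons => /eqP /PQ. Qed.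

Lemma leq_cnt t P Q : (forall m, mdeg m = t -> P m -> Q m) -> (cnt t P <= cnt t Q)%N.
Proof.
move=> PQ; rewrite /cnt -!size_filter uniq_leq_size ?(filter_uniq _ (uniq_mons t)) //.
by move=> m; rewrite !mem_filter_mons => /andP[Pm /eqP mt]; rewrite PQ // mt eqxx.
Qed.

Lemma cnt_split t P Q :
  cnt t P = (cnt t (fun m => P m && Q m) + cnt t (fun m => P m && ~~ Q m))%N.
Proof.
by rewrite /cnt; elim: (mons t) => //= m s ->; case: (P m); case: (Q m) => /=; lia.
Qed.

Lemma leq_cnt_inj t t' P Q (f : 'X_{1..n} -> 'X_{1..n}) :
  (forall m, mdeg m = t -> P m -> mdeg (f m) = t' /\ Q (f m)) ->
  (forall m m', mdeg m = t -> mdeg m' = t -> P m -> P m' -> f m = f m' -> m = m') ->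
  (cnt t P <= cnt t' Q)%N.
Proof.
move=> fPQ finj; rewrite /cnt -!size_filter -(size_map f); apply: uniq_leq_size.
  rewrite map_inj_in_uniq ?(filter_uniq _ (uniq_mons t)) // => m m'.
  by rewrite !mem_filter_mons => /andP[? /eqP ?] /andP[? /eqP ?]; apply: finj.
move=> x /mapP[m mP ->]; move: mP; rewrite mem_filter_mons => /andP[Pm /eqP mt].
by have [ft Qf] := fPQ m mt Pm; rewrite mem_filter_mons ft Qf eqxx.
Qed.

Lemma cnt_full t P Q :
  (forall m, mdeg m = t -> P m -> Q m) -> (cnt t Q <= cnt t P)%N ->
  forall m, mdeg m = t -> Q m -> P m.
Proof.
move=> PQ le m mt Qm; apply: contraT => nPm.
have e : cnt t (fun u => Q u && P u) = cnt t P.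
  by apply: eq_cnt => u ut; case Pu: (P u); rewrite ?andbF // PQ.
have := cnt_split t Q P; rewrite e.
suff: (0 < cnt t (fun m => Q m && ~~ P m))%N by lia.
by rewrite -has_count; apply/hasP; exists m; rewrite ?mem_mons ?mt //= Qm.
Qed.

Lemma cnt_gt0 t P m : mdeg m = t -> P m -> (0 < cnt t P)%N.
Proof. by move=> mt Pm; rewrite -has_count; apply/hasP; exists m; rewrite ?mem_mons ?mt. Qed.

Lemma cnt0 t P m : cnt t P = 0%N -> mdeg m = t -> ~~ P m.
Proof. by move=> c0 mt; apply/negP => /(cnt_gt0 mt); rewrite c0. Qed.

Lemma mdeg0_eq m : mdeg m = 0%N -> m = 0%MM.
Proof. by move/eqP; rewrite mdeg_eq0 => /eqP. Qed.

Lemma addmAC u v w : (u + v + w = u + w + v)%MM.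
Proof. by rewrite -!addmA [(v + w)%MM]addmC. Qed.

Lemma mulmDn u a b : (u *+ (a + b) = u *+ a + u *+ b)%MM.
Proof. by apply/mnmP => i; rewrite mnmDE !mulmnE mulnDr. Qed.

Lemma revlexP u v : mdeg u = mdeg v -> reflect
  (exists2 i : 'I_n, (u i < v i)%N & forall j : 'I_n, (i < j)%N -> u j = v j)
  (revlex_gt u v).
Proof.
rewrite /revlex_gt => e; rewrite e ltnn eqxx /=.
apply: (iffP existsP) => -[i].
  case/andP=> lt /forallP al; exists i => // j ij.
  by apply/eqP; have := al j; rewrite ij.
move=> lt al; exists i; rewrite lt /=; apply/forallP => j; apply/implyP => ij.
by rewrite al.
Qed.

Lemma revlex_total u v : u != v -> revlex_gt u v || revlex_gt v u.
Proof.
case: (ltngtP (mdeg u) (mdeg v)) => [lt|lt|e] ne.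
- by apply/orP; right; rewrite /revlex_gt lt.
- by apply/orP; left; rewrite /revlex_gt lt.
have [i0 ui0] : exists i, u i != v i.
  apply/existsP; rewrite -negb_forall; apply: contra ne => /forallP al.
  by apply/eqP/mnmP => i; apply/eqP.
have [i ui imax] := @arg_maxnP _ i0 (fun i => u i != v i) (fun i : 'I_n => nat_of_ord i) ui0.
have al : forall j : 'I_n, (i < j)%N -> u j = v j.
  by move=> j ij; apply/eqP; apply: contraT => /imax /(leq_trans ij); rewrite ltnn.
case: (ltngtP (u i) (v i)) ui => // lt _; apply/orP; [left|right].
  by apply/revlexP => //; exists i.
by apply/revlexP => //; exists i => // j /al ->.
Qed.

Lemma revlex_irr u : ~~ revlex_gt u u.
Proof. by apply/negP => /revlexP[] // i; rewrite ltnn. Qed.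

Lemma revlex_trans v u w : revlex_gt u v -> revlex_gt v w -> revlex_gt u w.
Proof.
move=> uv vw.
have le (a b : 'X_{1..n}) : revlex_gt a b -> (mdeg b <= mdeg a)%N.
  by rewrite /revlex_gt => /orP[/ltnW //|/andP[/eqP -> //]].
have := le _ _ uv; have := le _ _ vw.
case: (ltngtP (mdeg w) (mdeg v)) => // [lt1 _ le2|e1 _].
  by rewrite /revlex_gt (leq_trans lt1 le2).
case: (ltngtP (mdeg v) (mdeg u)) => // [lt2 _|e2 _].
  by rewrite /revlex_gt e1 lt2.
have /revlexP[// |i lti ali] := uv; have /revlexP[// |j ltj alj] := vw.
apply/revlexP; first by rewrite e1.
case: (ltngtP i j) => ij.
- by exists j => [|k jk]; rewrite ali // ?alj //; apply: ltn_trans jk.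
- by exists i => [|k ik]; rewrite -?alj // ?ali //; apply: ltn_trans ik.
have {}ij := ord_inj ij; subst j.
by exists i => [|k ik]; [apply: ltn_trans ltj | rewrite ali // alj].
Qed.

Lemma revlex_add u v w : revlex_gt (u + w)%MM (v + w)%MM = revlex_gt u v.
Proof.
rewrite /revlex_gt !mdegD ltn_add2r eqn_add2r; congr (_ || _ && _).
apply: eq_existsb => i; rewrite !mnmDE ltn_add2r; congr andb.
by apply: eq_forallb => j; rewrite !mnmDE eqn_add2r.
Qed.

Definition low (k : nat) m : bool := [forall i : 'I_n, (k <= i)%N ==> (m i == 0%N)].

Lemma lowP k m : reflect (forall i : 'I_n, (k <= i)%N -> m i = 0%N) (low k m).
Proof.
apply: (iffP forallP) => [al i ki|al i]; first by apply/eqP; have := al i; rewrite ki.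
by apply/implyP => /al ->.
Qed.

Lemma low_n m : low n m.
Proof. by apply/lowP => i; rewrite leqNgt ltn_ord. Qed.

Lemma lowS (k : 'I_n) m : low k m = low k.+1 m && (m k < 1)%N.
Proof.
apply/lowP/andP => [al|[/lowP al mk] i].
  split; last by rewrite al.
  by apply/lowP => i ki; rewrite al // ltnW.
rewrite leq_eqVlt => /orP[/eqP ki|/al //].
by rewrite (ord_inj (esym ki)); case: (m k) mk.
Qed.

End Monomials.

(* [hdiff f s t] is the expected dimension of the cokernel of a map of full rank
   from degree [t - s] to degree [t]. *)
Definition hdiff (f : nat -> nat) (s t : nat) : nat :=
  (f t - (if s <= t then f (t - s) else 0))%N.

(** * Order ideals of monomials with the expected prefix counts *)

Section StandardMonomials.
Context (n : nat) (D : pred 'X_{1..n}) (h : nat -> nat).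
Implicit Types (m u v : 'X_{1..n}).
Hypothesis D_down : forall m m', D (m + m')%MM -> D m.

Local Notation Dlow k := (fun m => D m && low k m).

Lemma cnt_shift (k : 'I_n) s t : (s <= t)%N ->
  (cnt t (Dlow k.+1) <= cnt t (fun m => Dlow k.+1 m && (m k < s)%N)
     + cnt (t - s) (fun m => low k.+1 m && D (m + U_(k) *+ s)%MM))%N.
Proof.
move=> st; rewrite (cnt_split t (Dlow k.+1) (fun m => m k < s)%N) leq_add2l.
have sub m : (s <= m k)%N -> (m - U_(k) *+ s + U_(k) *+ s)%MM = m.
  move=> le; apply/mnmP => i; rewrite mnmDE mnmBE mulmnE mnm1E.
  case: eqP => [<-|_]; last by rewrite mul0n subn0 addn0.
  by rewrite mul1n subnK.
apply: (leq_cnt_inj (f := fun m => (m - U_(k) *+ s)%MM)) => [m mt|m m' _ _].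
  rewrite -leqNgt => /andP[/andP[Dm /lowP lm] sm]; split.
    by have := congr1 (@mdeg n) (sub _ sm); rewrite mdegD mdegMn mdeg1 mt; lia.
  rewrite sub // Dm andbT; apply/lowP => i ki.
  by rewrite mnmBE lm.
rewrite -!leqNgt => /andP[_ sm] /andP[_ sm'] e.
by rewrite -(sub _ sm) e sub.
Qed.

Hypothesis count_D : forall t, cnt t D = h t.
Hypothesis count_low : forall (k : 'I_n) s t,
  (cnt t (fun m => Dlow k.+1 m && (m k < s)%N)
     <= hdiff (iter (n - k.+1) Delta h) s t)%N.


(** The bound [count_low] with [s = 1] is sharp: by [cnt_shift], discarding the multiples of [x_k]
    removes at most as many monomials as there are one degree lower. Descending induction from
    [k = n], where the count is [h]. *)
Lemma cnt_low (k : nat) t : (k <= n)%N -> cnt t (Dlow k) = iter (n - k) Delta h t.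
Proof.
move=> kn; have [j ej] : exists j, (n - k)%N = j by eexists.
elim: j k t kn ej => [|j IH] k t kn ej.
  have -> : k = n by lia.
  rewrite subnn /= -count_D; apply: eq_cnt => m _; by rewrite low_n andbT.
have kn' : (k < n)%N by lia.
have ej' : (n - k.+1)%N = j by lia.
pose ko := Ordinal kn'; rewrite ej iterS -ej'.
rewrite (eq_cnt (Q := fun m => Dlow k.+1 m && (m ko < 1)%N)); last first.
  by move=> m _; rewrite (lowS ko) andbA.
have up := count_low ko 1 t; rewrite /hdiff /= in up.
case: t up => [|t] up /=.
  have -> : cnt 0 (fun m => Dlow k.+1 m && (m ko < 1)%N) = cnt 0 (Dlow k.+1).
    by apply: eq_cnt => m /mdeg0_eq ->; rewrite mnm0E andbT.
  by rewrite IH.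
have := cnt_shift ko (s := 1) (t := t.+1) isT.
have le : (cnt (t.+1 - 1) (fun m => low ko.+1 m && D (m + U_(ko) *+ 1)%MM)
           <= cnt (t.+1 - 1) (Dlow ko.+1))%N.
  by apply: leq_cnt => m _ /andP[-> /D_down ->].
have := IH k.+1 t.+1 kn' ej'; have := IH k.+1 t kn' ej'.
rewrite subn1 /= in le up *. rewrite /= in up.
set a := iter _ _ _ t.+1 in up *; set b := iter _ _ _ t in up *.
by move=> e1 e2; rewrite e2; move: le; rewrite e1; lia.
Qed.

(** When the expected count does not drop from degree [i] to [e], at most the difference of the
    counts is not divisible by [x_k ^ (e - i)]. The remaining ones are then as many as all standard
    monomials of degree [i], so each of these has a standard multiple. *)
Lemma mult_inj (k : 'I_n) i e m : (i <= e)%N ->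
  (iter (n - k.+1) Delta h i <= iter (n - k.+1) Delta h e)%N ->
  mdeg m = i -> D m -> low k.+1 m -> D (m + U_(k) *+ (e - i))%MM.
Proof.
move=> ie hle mi Dm lm.
have st : (e - i <= e)%N by lia.
have := cnt_shift k st; have := count_low k (e - i) e.
rewrite /hdiff st subKn // cnt_low // => c1 c2.
have /andP[] // : low k.+1 m && D (m + U_(k) *+ (e - i))%MM.
apply: (@cnt_full _ i (fun m => low k.+1 m && D (m + U_(k) *+ (e - i))%MM)
  (Dlow k.+1)) => //; last by rewrite Dm.
  by move=> u _ /andP[-> /D_down ->].
by rewrite cnt_low //; lia.
Qed.

(** Here the truncated difference bounding the prefix count is zero. *)
Lemma mult_surj (k : 'I_n) i e m : (i <= e)%N ->
  (iter (n - k.+1) Delta h e <= iter (n - k.+1) Delta h i)%N ->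
  mdeg m = e -> D m -> low k.+1 m -> (e - i <= m k)%N.
Proof.
move=> ie hle me Dm lm.
have st : (e - i <= e)%N by lia.
have := count_low k (e - i) e.
rewrite /hdiff st subKn // => c1.
have c0 : cnt e (fun m => Dlow k.+1 m && (m k < e - i)%N) = 0%N by lia.
by have := cnt0 c0 me; rewrite Dm lm /= -leqNgt.
Qed.

Hypothesis quasi : forall k : nat, (k + 4 <= n)%N -> quasi_symmetric (iter k Delta h).
Hypothesis exchange : forall i0 i1 : 'I_n, i0 = 0%N :> nat -> i1 = 1%N :> nat ->
  (3 <= n)%N -> forall m, low 3 m -> D (m + U_(i0))%MM -> D (m + U_(i1))%MM.

Lemma unimodal_max (f : nat -> nat) p :
  (forall j, (j < p)%N -> (f j < f j.+1)%N) ->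
  (forall j, (p <= j)%N -> (f j.+1 <= f j)%N) -> forall j, (f j <= f p)%N.
Proof.
move=> inc dec j; case: (leqP p j) => [|/ltnW] pj.
  rewrite -(subnKC pj); elim: (j - p)%N => [|d IH]; first by rewrite addn0.
  by apply: leq_trans IH; rewrite addnS dec // leq_addr.
rewrite -(subKn pj); elim: (p - j)%N => [|d IH]; first by rewrite subn0.
case: (ltnP d p) => dp; last by rewrite (_ : p - d.+1 = p - d)%N //; lia.
by apply: leq_trans IH; have := inc (p - d.+1)%N; rewrite -subSn // subSS; lia.
Qed.

Lemma exchange_iter (i0 i1 : 'I_n) : i0 = 0%N :> nat -> i1 = 1%N :> nat ->
  (3 <= n)%N -> forall a m, low 3 m ->
  D (m + U_(i0) *+ a)%MM -> D (m + U_(i1) *+ a)%MM.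
Proof.
move=> e0 e1 n3; elim=> [|a IH] m lm; first by rewrite !mulm0n.
rewrite ![(_ *+ a.+1)%MM]mulmSr !addmA => DD.
have low1 (i : 'I_n) u : (i < 3)%N -> low 3 u -> low 3 (u + U_(i))%MM.
  move=> i3 /lowP lu; apply/lowP => j j3; rewrite mnmDE lu // mnm1E.
  by case: eqP => // ij; move: i3; rewrite ij ltnNge j3.
have lm' : low 3 (m + U_(i0) *+ a)%MM.
  elim: a {DD IH} => [|a IHa]; first by rewrite mulm0n addm0.
  by rewrite mulmSr addmA; apply: low1 => //; rewrite e0.
have := exchange e0 e1 n3 lm' DD; rewrite addmAC => H.
by rewrite addmAC; apply: IH H; apply: low1 => //; rewrite e1.
Qed.

Lemma revlex_low2 (i0 i1 : 'I_n) u v : i0 = 0%N :> nat -> i1 = 1%N :> nat ->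
  mdeg v = mdeg u -> revlex_gt v u -> (forall i : 'I_n, (1 < i)%N -> v i = u i) ->
  (v i1 < u i1)%N /\ exists a w, v = (w + U_(i0) *+ a)%MM /\ u = (w + U_(i1) *+ a)%MM.
Proof.
move=> e0 e1 evu gt tl.
have ne : (i1 == i0) = false by rewrite -(inj_eq val_inj) /= e0 e1.
have e01 : (v i0 + v i1 = u i0 + u i1)%N.
  have dE w : mdeg w = (w i0 + w i1 + \sum_(i < n | (i != i0) && (i != i1)) w i)%N.
    by rewrite mdegE (bigD1 i0) //= (bigD1 i1) ?ne //= addnA.
  have e : (\sum_(i < n | (i != i0) && (i != i1)) v i
            = \sum_(i < n | (i != i0) && (i != i1)) u i)%N.
    apply: eq_bigr => i /andP[n0 n1]; apply: tl.
    move: n0 n1; rewrite -!(inj_eq val_inj) /= e0 e1; clear; lia.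
  by move/eqP: evu; rewrite !dE e eqn_add2r => /eqP.
have lt1 : (v i1 < u i1)%N.
  have /revlexP[// |j ltj alj] := gt.
  have jtl : (1 < j)%N -> False by move/tl => e; rewrite e ltnn in ltj.
  have : j = i0 \/ j = i1.
    have : (j : nat) = 0%N \/ (j : nat) = 1%N by move: jtl; clear; lia.
    by case=> ej; [left|right]; apply: val_inj; rewrite /= ?e0 ?e1.
  case=> ej; rewrite ej in ltj alj => //.
  have := alj i1; rewrite e0 e1 => /(_ isT) e.
  by move: e01 ltj; rewrite e; clear; lia.
split=> //; pose a := (u i1 - v i1)%N; exists a, (v - U_(i0) *+ a)%MM.
have a0 : (a <= v i0)%N by move: e01 lt1; rewrite /a; clear; lia.
split; apply/mnmP => i; rewrite mnmDE mnmBE !mulmnE !mnm1E.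
  by case: eqP => [<-|_]; rewrite ?mul1n ?mul0n ?subn0 ?addn0 // subnK.
case: (ltngtP i 1) => i1'.
- have -> : i = i0 by apply: val_inj; move: i1' => /=; rewrite e0; clear; lia.
  by rewrite eqxx ne; move: e01 lt1; rewrite /a; clear; lia.
- have -> : (i0 == i) = false by rewrite -(inj_eq val_inj) /= e0; move: i1'; clear; lia.
  have -> : (i1 == i) = false by rewrite -(inj_eq val_inj) /= e1; move: i1'; clear; lia.
  by rewrite -tl // subn0 addn0.
have -> : i = i1 by apply: val_inj; rewrite /= e1.
by rewrite eqxx [i0 == _]eq_sym ne; move: lt1; rewrite /a; clear; lia.
Qed.

(** Suppose [v] is standard and let [x_k] be the last variable of [u]. Full rank of the powers of
    [x_k] on standard monomials forces equal exponents of [x_k] in [u] and [v], so the two differ in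
    an earlier variable; the cases [k >= 3] and [k = 2] are then contradicted by different means. *)
Lemma std_almost_revlex u v : ~~ D u ->
  (forall m, (m <= u)%MM -> m != u -> D m) ->
  mdeg v = mdeg u -> revlex_gt v u -> ~~ D v.
Proof.
move=> nDu minu evu gt; apply/negP => Dv.
have /revlexP[// |j ltj alj] := gt.
have uj : u j != 0%N by case: (u j) ltj.
have [k uk kmax] := @arg_maxnP _ j (fun i => u i != 0%N) (fun i : 'I_n => nat_of_ord i) uj.
set c := u k in uk.
have lu : low k.+1 u.
  apply/lowP => i ki; apply/eqP; apply: contraT => /kmax /(leq_trans ki).
  by rewrite ltnn.
have jk : (j <= k)%N := kmax _ uj.
have lv : low k.+1 v.
  apply/lowP => i ki; rewrite alj ?(leq_ltn_trans jk) //.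
  by apply: (lowP _ _ lu).
pose m := (u - U_(k) *+ c)%MM.
have um : u = (m + U_(k) *+ c)%MM.
  apply/mnmP => i; rewrite mnmDE mnmBE mulmnE mnm1E.
  by case: eqP => [<-|_]; rewrite ?mul1n ?mul0n ?subn0 ?addn0 // subnn.
have mk : m k = 0%N by rewrite mnmBE mulmnE mnm1E eqxx mul1n subnn.
have lm : low k m.
  rewrite lowS mk andbT; apply/lowP => i ki; rewrite mnmBE (lowP _ _ lu) //.
have lm' : low k.+1 m by move: lm; rewrite lowS => /andP[].
have du : mdeg u = (mdeg m + c)%N by rewrite {1}um mdegD mdegMn mdeg1 mul1n.
have c0 : (0 < c)%N by rewrite lt0n.
have sub_u (w : 'X_{1..n}) : (w <= u)%MM -> (mdeg w < mdeg u)%N -> D w.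
  by move=> wu lt; apply: minu => //; apply: contraTneq lt => ->; rewrite ltnn.
have Dm : D m.
  apply: sub_u; last by rewrite du -addn1 leq_add2l.
  by apply/mnm_lepP => i; rewrite mnmBE leq_subr.
have lsub a : low k.+1 (m + U_(k) *+ a)%MM.
  apply/lowP => i ki; rewrite mnmDE (lowP _ _ lm') // mulmnE mnm1E.
  by case: eqP => // ike; move: ki; rewrite ike ltnn.
(* Otherwise multiplication by [x_k ^ (c - a)] is injective on standard monomials from degree
   [mdeg m + a] to degree [mdeg u] and makes [u] standard. *)
have noinj a : (a <= c)%N -> D (m + U_(k) *+ a)%MM ->
    (iter (n - k.+1) Delta h (mdeg u) < iter (n - k.+1) Delta h (mdeg m + a))%N.
  move=> ac Da; rewrite ltnNge; apply: contra nDu => hh.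
  rewrite um -(subnKC ac) mulmDn addmA.
  have -> : (c - a = mdeg u - (mdeg m + a))%N by rewrite du subnDl.
  apply: mult_inj => //; first by rewrite du leq_add2l.
  by rewrite mdegD mdegMn mdeg1 mul1n.
(* If [v k < c], multiplication by [x_k ^ c] is not surjective onto the degree of [v],
   hence it is injective, which would give [D u]. *)
have vk : v k = c.
  apply/eqP; rewrite eqn_leq; case: (eqVneq j k) => [jke|ne]; last first.
    by rewrite alj ?leqnn // ltn_neqAle jk andbT.
  exfalso; have := noinj 0%N; rewrite mulm0n addm0 addn0 => /(_ isT Dm) hh.
  have := mult_surj _ (ltnW hh) evu Dv lv; rewrite du leq_addr => /(_ isT).
  by rewrite addKn leqNgt; case/negP; move: ltj; rewrite jke.
have jk' : (j < k)%N.
  rewrite ltn_neqAle jk andbT; apply/eqP => jke.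
  by move: ltj; rewrite (ord_inj jke) vk ltnn.
have kn := ltn_ord k.
case: (leqP k 2) => k2; last first.
  (* Quasi-symmetry yields [l] at or before the peak with [f l = f (mdeg u)], so that
     multiplication by [x_k ^ (mdeg u - l)] is bijective between these degrees: if
     [mdeg m <= l] it keeps [u] standard, otherwise it does not reach [v]. *)
  have qs : quasi_symmetric (iter (n - k.+1) Delta h) by apply: quasi; move: kn k2; clear; lia.
  set f := iter (n - k.+1) Delta h in qs.
  case: qs => c1 [pos zer [p [inc dec]] qs].
  have Dsub : D (m + U_(k) *+ c.-1)%MM.
    apply: sub_u; last by rewrite du mdegD mdegMn mdeg1 mul1n ltn_add2l prednK.
    by rewrite um; apply/mnm_lepP => i; rewrite !mnmDE !mulmnE leq_add2l leq_mul2l leq_pred orbT.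
  have upred : (mdeg m + c.-1 = (mdeg u).-1)%N by case: (c) c0 du => // c' _ ->; rewrite addnS.
  (* The case [a = c - 1]: the monomial is a proper divisor of [u], hence standard. This drop places
     [mdeg u] after the peak, where quasi-symmetry applies. *)
  have fe : (f (mdeg u) < f (mdeg u).-1)%N by rewrite -upred; apply: noinj; rewrite ?leq_pred.
  have maxp := unimodal_max inc dec.
  have fu : (0 < f (mdeg u))%N.
    rewrite /f -cnt_low //; apply: (cnt_gt0 (m := v)) => //=.
    by rewrite Dv lv.
  have uc : (mdeg u <= c1)%N by rewrite leqNgt; apply/negP => /zer e; rewrite e in fu.
  have pc : (p <= c1)%N.
    rewrite leqNgt; apply/negP => /zer e; have := maxp (mdeg u); rewrite e.
    by case: (f _) fu.
  have pu : (p < mdeg u)%N.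
    have u0 : (0 < mdeg u)%N by rewrite du addn_gt0 c0 orbT.
    rewrite ltnNge; apply/negP => le; have := inc (mdeg u).-1.
    by rewrite prednK // => /(_ le); rewrite ltnNge ltnW.
  have [l lp fl] := qs p pc (fun j _ => maxp j) (mdeg u) (introT andP (conj pu uc)).
  have lu' : (l < mdeg u)%N := leq_ltn_trans lp pu.
  case: (leqP (mdeg m) l) => ml.
    have lp' : (l < p)%N.
      rewrite ltn_neqAle lp andbT; apply/eqP => e; have := maxp (mdeg u).-1.
      by rewrite -e -fl leqNgt fe.
    have Dl : D (m + U_(k) *+ (l - mdeg m))%MM.
      apply: (@D_down _ (U_(k) *+ (c.-1 - (l - mdeg m)))%MM).
      rewrite -addmA -mulmDn subnKC // -(leq_add2l (mdeg m)) upred subnKC //.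
      by rewrite -ltnS prednK ?(leq_ltn_trans _ lu').
    have lc : (l - mdeg m <= c)%N.
      by rewrite -(leq_add2l (mdeg m)) subnKC // -du ltnW.
    by have := noinj _ lc Dl; rewrite subnKC // -/f fl ltnn.
  have := mult_surj (k := k) (i := l) (e := mdeg u) (m := v).
  rewrite -/f fl leqnn (ltnW lu') evu Dv lv vk.
  move/(_ isT isT erefl isT isT); rewrite leqNgt => /negP; apply.
  move: ml lu'; rewrite du; move: (mdeg m) (c); clear; lia.
(* From here on [u] and [v] agree from [x_2] on, so they differ by a trade of [x_1] for [x_0]. Now
   [k = 0] contradicts [j < k], and [k = 1] contradicts [v k = c]; for [k = 2] the exchange turns
   [v] into [u]. *)
have k1 : (1 <= k)%N by apply: leq_ltn_trans jk'.
have i1P : (1 < n)%N := leq_ltn_trans k1 (ltn_ord k).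
pose i0 := Ordinal (ltnW i1P); pose i1 := Ordinal i1P.
have tl (i : 'I_n) : (1 < i)%N -> v i = u i.
  rewrite leq_eqVlt => /orP[/eqP i2|i2]; last first.
    by rewrite (lowP _ _ lv) ?(lowP _ _ lu) // (leq_ltn_trans k2).
  case: (ltngtP i k) => [ik|ik|/ord_inj -> //]; last first.
    by rewrite (lowP _ _ lv) ?(lowP _ _ lu).
  by move: (leq_trans ik k2); rewrite -i2.
have [lt1 [a [w [vw uw]]]] :=
  @revlex_low2 i0 i1 u v erefl erefl evu gt tl.
have ek : k = 2 :> nat.
  apply/eqP; rewrite eqn_leq k2 /= ltn_neqAle k1 andbT; apply/eqP => e1.
  by move: lt1; rewrite (_ : i1 = k) ?vk ?ltnn //; apply: val_inj.
have n3 : (2 < n)%N by rewrite -ek.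
move/negP: nDu; apply; rewrite uw.
apply: (exchange_iter (i0 := i0)) => //; last by rewrite -vw.
apply/lowP => i i3; have := lowP _ _ lu i; rewrite ek i3 uw mnmDE => /(_ isT) /eqP.
by rewrite addn_eq0 => /andP[/eqP].
Qed.

End StandardMonomials.

Import GRing.Theory.
Local Open Scope ring_scope.

(** * Monomial ideals *)

(** Counting monomials takes boolean predicates, while membership in an ideal is a proposition. *)
Definition asb (P : Prop) : bool := if excluded_middle_informative P then true else false.

Lemma asbP (P : Prop) : reflect P (asb P).
Proof. by rewrite /asb; case: excluded_middle_informative => ?; constructor. Qed.

Section IdealBasics.
Context (n : nat) (K : fieldType).
Local Notation R := {mpoly K[n]}.
Implicit Types (I J S : R -> Prop) (p q f : R) (M : 'X_{1..n} -> Prop).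

Lemma ideal_gen_ideal S : is_ideal (ideal_gen S).
Proof.
split=> [J [] //|p q Sp Sq J JI SJ|f p Sp J JI SJ]; have [J0 JD JM] := JI.
  by apply: JD; [apply: Sp | apply: Sq].
by apply: JM; apply: Sp.
Qed.

Lemma ideal_genW S p : S p -> ideal_gen S p.
Proof. by move=> Sp J _; apply. Qed.

Lemma ideal_gen_min S J : is_ideal J -> (forall p, S p -> J p) ->
  forall p, ideal_gen S p -> J p.
Proof. by move=> JI SJ p; apply. Qed.

Lemma same_set_sym I J : same_set I J -> same_set J I.
Proof. by move=> IJ p; split => /IJ. Qed.

Section LinearClosure.
Context (I : R -> Prop) (II : is_ideal I).

Lemma ideal0 : I 0. Proof. by case: II. Qed.

Lemma idealD p q : I p -> I q -> I (p + q).
Proof. by case: II => _ + _; apply. Qed.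

Lemma idealM f p : I p -> I (f * p).
Proof. by case: II => _ _; apply. Qed.

Lemma idealZ (c : K) p : I p -> I (c *: p).
Proof. by rewrite -mul_mpolyC; apply: idealM. Qed.

Lemma idealN p : I p -> I (- p).
Proof. by rewrite -scaleN1r; apply: idealZ. Qed.

Lemma idealB p q : I p -> I q -> I (p - q).
Proof. by move=> Ip Iq; apply: idealD => //; apply: idealN. Qed.

Lemma ideal_sum (A : Type) (r : seq A) (P : pred A) (F : A -> R) :
  (forall i, P i -> I (F i)) -> I (\sum_(i <- r | P i) F i).
Proof. by move=> IF; apply: big_ind => //; [apply: ideal0 | apply: idealD]. Qed.

Lemma idealBl p q : I (p - q) -> I q -> I p.
Proof. by move=> Ipq Iq; rewrite -(subrK q p); apply: idealD. Qed.

End LinearClosure.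

Lemma dim_component_leq I t d d' : is_ideal I ->
  dim_component I t d -> dim_component I t d' -> (d <= d')%N.
Proof.
move=> II [b [hb fb _]] [b' [_ _ sb']].
have [C CP] := fin_all_exists (fun i => sb' (b i) (hb i)).
pose A := \matrix_(i < d, j < d') C i j.
have : row_free A.
  apply/inj_row_free => v vA; apply/rowP => i; rewrite mxE.
  apply: (fb (fun i => v 0 i)).
  have -> : \sum_i v 0 i *: b i = \sum_i v 0 i *: (b i - \sum_j C i j *: b' j).
    under [RHS]eq_bigr do rewrite scalerBr.
    rewrite sumrB [X in _ - X](_ : _ = 0) ?subr0 //.
    under eq_bigr do rewrite scaler_sumr.
    rewrite exchange_big big1 //= => j _.
    under eq_bigr do rewrite scalerA.
    rewrite -scaler_suml; have /matrixP/(_ 0 j) := vA; rewrite !mxE.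
    by under eq_bigr do rewrite mxE; move=> ->; rewrite scale0r.
  by apply: (ideal_sum II) => i' _; apply: (idealZ II).
by rewrite -row_leq_rank => le; apply: leq_trans le (rank_leq_col _).
Qed.

Lemma dim_component_uniq I t d d' : is_ideal I ->
  dim_component I t d -> dim_component I t d' -> d = d'.
Proof.
by move=> II Id Id'; apply/eqP; rewrite eqn_leq !(dim_component_leq II Id Id', dim_component_leq II Id' Id).
Qed.

Lemma eq_dim_component I J t d : same_set I J -> dim_component I t d -> dim_component J t d.
Proof.
move=> IJ [b [hb fb sb]]; exists b; split=> // [c /IJ /fb //|p /sb [c /IJ Jc]].
by exists c.
Qed.

Definition supp_in M p : Prop := forall m, m \in msupp p -> M m.

Definition upclosed M : Prop := forall m m', M m -> M (m + m')%MM.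

Lemma supp_in_ideal M : upclosed M -> is_ideal (supp_in M).
Proof.
move=> MM; split=> [m|p q Mp Mq m|f p Mp m]; first by rewrite msupp0.
  by move/msuppD_le; rewrite mem_cat => /orP[/Mp|/Mq].
by move/msuppM_le/allpairsP => [[m1 m2] /= [_ /Mp m2M ->]]; rewrite addmC; apply: MM.
Qed.

Lemma supp_inX M m : supp_in M 'X_[m] <-> M m.
Proof. by split=> [|Mm k]; [apply; rewrite msuppX inE | rewrite msuppX inE => /eqP ->]. Qed.

Lemma monomial_genE M : upclosed M ->
  same_set (ideal_gen (fun p => exists2 m, M m & p = 'X_[m])) (supp_in M).
Proof.
move=> MM p; split.
  by apply: ideal_gen_min; [apply: supp_in_ideal | move=> _ [m Mm ->]; apply/supp_inX].
move=> Mp; rewrite (mpolyE p) big_seq.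
have II := ideal_gen_ideal (fun p => exists2 m, M m & p = 'X_[m]).
apply: (ideal_sum II) => m mp; apply: (idealZ II); apply: ideal_genW.
by exists m => //; apply: Mp.
Qed.

Lemma monomial_idealP J : monomial_ideal J ->
  same_set J (supp_in (fun m => J 'X_[m])) /\ upclosed (fun m => J 'X_[m]).
Proof.
case=> S JS; have II := ideal_gen_ideal (fun p => exists2 m, S m & p = 'X_[m]).
have up : upclosed (fun m => J 'X_[m]).
  by move=> m m' /JS Jm; apply/JS; rewrite addmC mpolyXD; apply: (idealM II).
split=> // p; split=> [/JS|Mp].
  apply: ideal_gen_min; first exact: supp_in_ideal.
  move=> _ [m Sm ->]; apply/supp_inX; apply/JS; apply: ideal_genW; by exists m.
apply/JS; rewrite (mpolyE p) big_seq; apply: (ideal_sum II) => m mp.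
by apply: (idealZ II); apply/JS; apply: Mp.
Qed.

Lemma coeff_sum_nth (d : nat) (s : seq 'X_{1..n}) (c : 'I_d -> K) :
  uniq s -> size s = d -> forall i : 'I_d,
  (\sum_(j < d) c j *: 'X_[nth 0%MM s j] : R)@_(nth 0%MM s i) = c i.
Proof.
move=> us sd i; rewrite raddf_sum /= (bigD1 i) //= big1 ?addr0.
  by rewrite mcoeffZ mcoeffX eqxx mulr1.
move=> j ji; rewrite mcoeffZ mcoeffX nth_uniq ?sd //.
by rewrite (inj_eq val_inj) (negbTE ji) mulr0.
Qed.

Lemma dim_supp_in M t : dim_component (supp_in M) t (cnt t (fun m => ~~ asb (M m))).
Proof.
set P := fun m => _; pose s := filter P (mons n t).
have ss : size s = cnt t P by rewrite size_filter.
have us : uniq s := filter_uniq _ (uniq_mons _ _).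
have sP m : m \in s = P m && (mdeg m == t) by rewrite mem_filter_mons.
exists (fun i => 'X_[nth 0%MM s i]); split=> [i|c Mc i|p hp].
- by rewrite dhomogX; have := mem_nth 0%MM (etrans (congr1 _ ss) (ltn_ord i)); rewrite sP => /andP[].
- apply/eqP; apply: contraT => ci.
  have := Mc (nth 0%MM s i); rewrite mcoeff_msupp coeff_sum_nth // => /(_ ci).
  have := mem_nth 0%MM (etrans (congr1 _ ss) (ltn_ord i)).
  by rewrite sP => /andP[/asbP].
exists (fun i => p@_(nth 0%MM s i)) => m; rewrite mcoeff_msupp mcoeffB.
move=> nz; apply: NNPP => nM; move/negP: nz; apply; rewrite subr_eq0 eq_sym; apply/eqP.
case: (eqVneq (mdeg m) t) => [mt|mt]; last first.
  rewrite (dhomog_nemf_coeff hp mt) raddf_sum big1 //= => i _.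
  rewrite mcoeffZ mcoeffX; case: eqP => [e|_]; last by rewrite mulr0.
  have := mem_nth 0%MM (etrans (congr1 _ ss) (ltn_ord i)).
  by rewrite e sP (negbTE mt) andbF.
have ms : m \in s by rewrite sP mt eqxx andbT; apply/asbP.
have mi : (index m s < cnt t P)%N by rewrite -ss index_mem.
have := coeff_sum_nth (fun i : 'I_(cnt t P) => p@_(nth 0%MM s i)) us ss (Ordinal mi).
by rewrite /= nth_index.
Qed.

(** Once the ideals agree below degree [t], a monomial of degree [t] in only one of them is a
    minimal generator of that one. If each ideal had such a monomial, the larger of the two would
    belong to the ideal lacking it. So the parts of degree [t] are nested, and equal counts make
    them equal. *)
Lemma almost_revlex_uniq J J' h : almost_revlex J -> almost_revlex J' ->
  hilbert_function J h -> hilbert_function J' h -> same_set J J'.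
Proof.
move=> [mJ aJ] [mJ' aJ'] hJ hJ'.
have [sJ uJ] := monomial_idealP mJ; have [sJ' uJ'] := monomial_idealP mJ'.
have cJ t : cnt t (fun m => ~~ asb (J 'X_[m])) = cnt t (fun m => ~~ asb (J' 'X_[m])).
  rewrite (dim_component_uniq (supp_in_ideal uJ) (dim_supp_in _ t) (eq_dim_component sJ (hJ t))).
  by rewrite (dim_component_uniq (supp_in_ideal uJ') (dim_supp_in _ t) (eq_dim_component sJ' (hJ' t))).
suff JJ m : J 'X_[m] <-> J' 'X_[m].
  by move=> p; split=> [/sJ Mp|/sJ' Mp]; [apply/sJ'|apply/sJ] => m /Mp /JJ.
have [t mt] : exists t, mdeg m = t by eexists.
elim/ltn_ind: t m mt => t IH m mt.
have mingen (J1 J2 : R -> Prop) u : upclosed (fun m => J2 'X_[m]) ->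
    (forall v, (mdeg v < t)%N -> J1 'X_[v] -> J2 'X_[v]) ->
    mdeg u = t -> J1 'X_[u] -> ~ J2 'X_[u] -> minimal_generator J1 u.
  move=> up2 sub ut J1u nJ2u; split=> // v J1v vu.
  have uv : u = (v + (u - v))%MM by rewrite addmC submK.
  case: (posnP (mdeg (u - v)%MM)) => [/mdeg0_eq e|gt]; first by rewrite uv e addm0.
  case: nJ2u; rewrite uv; apply: up2; apply: sub => //.
  by rewrite -ut (congr1 (@mdeg n) uv) mdegD -[X in (X < _)%N]addn0 ltn_add2l.
have min1 u := mingen J J' u uJ' (fun v lt => proj1 (IH _ lt v erefl)).
have min2 u := mingen J' J u uJ (fun v lt => proj2 (IH _ lt v erefl)).
have incl : (forall u, mdeg u = t -> J 'X_[u] -> J' 'X_[u]) \/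
            (forall u, mdeg u = t -> J' 'X_[u] -> J 'X_[u]).
  have [[u [ut Ju nJ'u]]|no] :=
    classic (exists u, [/\ mdeg u = t, J 'X_[u] & ~ J' 'X_[u]]); last first.
    by left=> u ut Ju; apply: NNPP => nJ'u; case: no; exists u.
  right=> v vt J'v; apply: NNPP => nJv.
  have uv : u != v by apply/eqP => e; apply: nJ'u; rewrite e.
  case/orP: (revlex_total uv) => gt.
    by apply: nJ'u; apply: (aJ' v) gt => //; [apply: min2 | rewrite ut].
  by apply: nJv; apply: (aJ u) gt => //; [apply: min1 | rewrite vt].
have full (J1 J2 : R -> Prop) : (forall u, mdeg u = t -> J1 'X_[u] -> J2 'X_[u]) ->
    cnt t (fun m => ~~ asb (J1 'X_[m])) = cnt t (fun m => ~~ asb (J2 'X_[m])) ->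
    J1 'X_[m] <-> J2 'X_[m].
  move=> sub e; split; first exact: sub.
  move=> J2m; apply: NNPP => nJ1m.
  suff /asbP : ~~ asb (J2 'X_[m]) by [].
  apply: (@cnt_full _ t (fun m => ~~ asb (J2 'X_[m])) (fun m => ~~ asb (J1 'X_[m]))) => //.
  - by move=> u ut; apply: contra => /asbP /(sub u ut) /asbP.
  - by rewrite e.
  - exact/asbP.
case: incl => sub; first exact: full.
by apply: iff_sym; apply: full.
Qed.

End IdealBasics.
Arguments supp_in_ideal {n K M}.

(** * Leading monomials *)

Section LinearAlgebra.
Context (K : fieldType).

Lemma row_free_completion d k (U : 'M[K]_(d, d + k)) : row_free U ->
  exists W : 'M_(k, d + k), col_mx U W \in unitmx.
Proof.
move=> fU; exists (dsubmx (row_ebase U)).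
have e := mulmx_ebase U; move: e; rewrite (eqP fU).
rewrite -{1}(vsubmxK (row_ebase U)) -mulmxA pid_mx_row mul_row_col mul1mx mul0mx addr0 => e.
have -> : col_mx U (dsubmx (row_ebase U))
    = block_mx (col_ebase U) 0 0 1%:M *m row_ebase U.
  rewrite -[X in _ *m X](vsubmxK (row_ebase U)) mul_block_col.
  by rewrite e !mul0mx mul1mx addr0 add0r.
by rewrite unitmx_mul row_ebase_unit unitmxE det_ublock det1 mulr1 -unitmxE col_ebase_unit.
Qed.

(** [1 - C *m E] has its rows in [P], and rank at least [q - N] because [C *m E] has rank at most
    [N]. *)
Lemma codim_rows N q (P : 'rV[K]_q -> Prop) (E : 'M_(N, q)) :
  P 0 -> (forall a u v, P u -> P v -> P (a *: u + v)) ->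
  (forall v, exists c : 'rV_N, P (v - c *m E)) ->
  exists2 F : 'M_(q - N, q), row_free F & forall i, P (row i F).
Proof.
move=> P0 PL PE.
have [C CP] := fin_all_exists (fun j : 'I_q => PE (row j 1%:M)).
pose A := 1%:M - (\matrix_j C j) *m E.
have PA i : P (row i A) by rewrite /A linearB /= row_mul rowK.
have rA : (q - N <= \rank A)%N.
  have := mxrank_add A ((\matrix_j C j) *m E); rewrite subrK mxrank1.
  have := leq_trans (mxrankM_maxr (\matrix_j C j) E) (rank_leq_row E).
  by move=> h1 h2; rewrite leq_subLR addnC; apply: leq_trans h2 _; rewrite leq_add2l.
pose B := \matrix_(i < q - N) row (widen_ord rA i) (row_base A).
exists B.
  have /row_freeP[B' BB'] : row_free (row_base A) by apply: row_base_free.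
  apply/row_freeP; exists (B' *m \matrix_(j, i) (j == widen_ord rA i)%:R).
  apply/matrixP => i j; rewrite mulmxA.
  have -> : B *m B' = \matrix_(i < q - N) row (widen_ord rA i) 1%:M.
    by apply/row_matrixP => i'; rewrite row_mul !rowK -row_mul BB'.
  rewrite !mxE (bigD1 (widen_ord rA i)) //= big1 ?addr0 => [|l li].
    by rewrite !mxE eqxx mul1r.
  by rewrite !mxE eq_sym (negbTE li) mul0r.
move=> i; rewrite rowK; have /submxP[D ->] : (row (widen_ord rA i) (row_base A) <= A)%MS.
  by rewrite (submx_trans (row_sub _ _)) ?eq_row_base.
rewrite mulmx_sum_row; apply: big_ind => // [u v Pu Pv|j _].
  by rewrite -[u]scale1r; apply: PL.
by rewrite -[X in P X]addr0; apply: PL.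
Qed.

End LinearAlgebra.

Section Leads.
Context (n : nat) (K : fieldType).
Local Notation R := {mpoly K[n]}.
Implicit Types (I J S : R -> Prop) (p q f : R).

Lemma mcoeff_pihomog d p m :
  (pihomog mdeg d p)@_m = if mdeg m == d then p@_m else 0.
Proof.
rewrite pihomogE raddf_sum /=; case: ifP => md.
  rewrite [in RHS](mpolyE p) raddf_sum /= big_mkcond /=; apply: eq_bigr => k _.
  case: ifP => // kd; rewrite mcoeffZ mcoeffX.
  by case: eqP => [e|_]; rewrite ?mulr0 //; rewrite -e kd in md.
rewrite big1 // => k kd; rewrite mcoeffZ mcoeffX.
by case: eqP => [e|_]; rewrite ?mulr0 //; rewrite -e kd in md.
Qed.

Lemma initial_exists p : p != 0 -> exists m, is_initial_monomial p m.
Proof.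
rewrite -msupp_eq0 /is_initial_monomial; elim: (msupp p) => // m s IH _.
case: (altP (s =P [::])) => [->|/IH [k [ks kmax]]].
  by exists m; split=> [|m']; rewrite ?inE // => /eqP ->; rewrite eqxx.
case: (eqVneq m k) => [->|mk].
  exists k; split=> [|m']; first by rewrite inE eqxx.
  by rewrite inE => /orP[/eqP ->|/kmax //]; rewrite eqxx.
case/orP: (revlex_total mk) => gt.
  exists m; split=> [|m']; first by rewrite inE eqxx.
  rewrite inE => /orP[/eqP ->|m's _]; first by rewrite eqxx.
  case: (eqVneq m' k) => [-> //|m'k].
  by apply: revlex_trans gt _; apply: kmax.
exists k; split=> [|m']; first by rewrite inE ks orbT.
by rewrite inE => /orP[/eqP ->|/kmax].
Qed.

Definition lead (L : R -> Prop) (m : 'X_{1..n}) : Prop :=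
  exists2 f, L f & is_initial_monomial f m.

Section GradedIdeal.
Context (L : R -> Prop) (gL : graded_ideal L).
Let iL : is_ideal L := proj1 gL.

Lemma lead_homog m : lead L m ->
  exists f, [/\ L f, f \is (mdeg m).-homog & is_initial_monomial f m].
Proof.
case=> f Lf [mf fmax]; exists (pihomog mdeg (mdeg m) f); split.
- exact: (proj2 gL).
- exact: pihomogP.
split; first by rewrite mcoeff_msupp mcoeff_pihomog eqxx -mcoeff_msupp.
move=> k; rewrite mcoeff_msupp mcoeff_pihomog; case: ifP => _; last by rewrite eqxx.
by rewrite -mcoeff_msupp; apply: fmax.
Qed.

Lemma lead_upclosed : upclosed (lead L).
Proof.
move=> m m' [f Lf [mf fmax]]; exists ('X_[m'] * f); first exact: (idealM iL).
have e k : (k \in msupp ('X_[m'] * f)) = (k \in [seq (m' + j)%MM | j <- msupp f]).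
  by rewrite mulrC; apply/perm_mem/msuppMX.
split; first by rewrite e [(m + m')%MM]addmC map_f.
move=> k; rewrite e => /mapP[j jf ->]; rewrite addmC => ne.
by rewrite revlex_add; apply: fmax => //; apply: contraNneq ne => ->.
Qed.

Lemma initial_idealE : same_set (initial_ideal L) (supp_in (lead L)).
Proof.
have E := monomial_genE (K := K) lead_upclosed.
move=> p; split.
  apply: (@ideal_gen_min _ _ _ (supp_in (lead L))); first exact: (supp_in_ideal lead_upclosed).
  by move=> _ [f [m [Lf fm ->]]]; apply/supp_inX; exists f.
move/E; apply: ideal_gen_min; first exact: ideal_gen_ideal.
by move=> _ [m [f Lf fm] ->]; apply: ideal_genW; exists f, m.
Qed.

(** Division with remainder. The initial term is cancelled by an element of [L], or moved to the
    remainder when it is standard; [N] bounds the number of monomials of degree [t] below any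
    monomial of [p]. *)
Lemma reduce_std t p : p \is t.-homog ->
  exists q, [/\ q \is t.-homog, L (p - q) & forall m, m \in msupp q -> ~ lead L m].
Proof.
have [N] : exists N, forall m, m \in msupp p -> (cnt t (revlex_gt m) < N)%N.
  exists (\max_(m <- msupp p) (cnt t (revlex_gt m))).+1 => m mp.
  by rewrite ltnS; apply: (leq_bigmax_seq (F := fun m => cnt t (revlex_gt m))).
elim: N p => [|N IH] p pN hp.
  exists 0; split=> [||m]; rewrite ?rpred0 ?subr0 ?msupp0 //.
  case: (eqVneq p 0) => [->|/initial_exists[m [/pN]] //]; exact: ideal0.
case: (eqVneq p 0) => [p0|/initial_exists[m [mp pmax]]].
  by exists 0; rewrite subr0 p0 rpred0; split=> // [|k]; rewrite ?msupp0 //; apply: ideal0.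
have mt : mdeg m = t := dhomog_mf hp mp.
have [g [hg gm gmax gL']] : exists g, [/\ g \is t.-homog, g@_m != 0,
    (forall k, k \in msupp g -> k != m -> revlex_gt m k) &
    L g \/ g = 'X_[m] /\ ~ lead L m].
  case: (classic (lead L m)) => [/lead_homog[f [Lf hf [mf fmax]]]|nm].
    exists f; rewrite -mcoeff_msupp mf -mt; split=> //; by left.
  exists 'X_[m]; rewrite mcoeffX eqxx oner_eq0; split=> // [|k|]; last by right.
    by rewrite dhomogX; apply/eqP.
  by rewrite msuppX inE => /eqP ->; rewrite eqxx.
pose c := p@_m / g@_m; pose p' := p - c *: g.
have hp' : p' \is t.-homog by apply: rpredB => //; apply: rpredZ.
have p'N k : k \in msupp p' -> (cnt t (revlex_gt k) < N)%N.
  move=> kp'; have kt := dhomog_mf hp' kp'.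
  have km : k != m.
    apply: contraTneq kp' => ->; rewrite mcoeff_msupp mcoeffB mcoeffZ.
    by rewrite divfK // subrr eqxx.
  have gt : revlex_gt m k.
    move: kp'; rewrite mcoeff_msupp mcoeffB mcoeffZ.
    case: (boolP (k \in msupp p)) => [kp _|/memN_msupp_eq0 ->]; first exact: pmax.
    case: (boolP (k \in msupp g)) => [kg _|/memN_msupp_eq0 ->]; first exact: gmax.
    by rewrite mulr0 subrr eqxx.
  rewrite -ltnS; apply: leq_trans (pN _ mp); rewrite ltnS.
  rewrite ltnNge; apply/negP => le.
  have := @cnt_full _ t (revlex_gt k) (revlex_gt m) _ le k kt gt.
  rewrite (negbTE (revlex_irr k)); case/(_ _)/notF => u ut.
  exact: revlex_trans gt.
have [q [hq Lq sq]] := IH _ p'N hp'.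
case: gL' => [Lg|[ge nm]].
  exists q; split=> //.
  have -> : p - q = (p' - q) + c *: g by rewrite /p' addrAC subrK.
  by apply: idealD => //; apply: idealZ.
exists (q + c *: g); split.
- by apply: rpredD => //; apply: rpredZ.
- by rewrite opprD addrA addrAC.
move=> k /msuppD_le; rewrite mem_cat => /orP[/sq //|/msuppZ_le].
by rewrite ge msuppX inE => /eqP ->.
Qed.

(** Macaulay's basis theorem: a nonzero combination of standard monomials lying in [L] would have a
    standard initial monomial. *)
Lemma dim_std t : dim_component L t (cnt t (fun m => ~~ asb (lead L m))).
Proof.
set P := fun m => _; pose s := filter P (mons n t).
have ss : size s = cnt t P by rewrite size_filter.
have us : uniq s := filter_uniq _ (uniq_mons _ _).
have sP m : m \in s = P m && (mdeg m == t) by rewrite mem_filter_mons.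
exists (fun i => 'X_[nth 0%MM s i]); split=> [i|c Lc i|p /reduce_std [q [hq Lq sq]]].
- by rewrite dhomogX; have := mem_nth 0%MM (etrans (congr1 _ ss) (ltn_ord i)); rewrite sP => /andP[].
- apply/eqP; apply: contraT => ci; set f := \sum_i _ in Lc.
  have f0 : f != 0.
    apply: contraNneq ci => f0; rewrite -(coeff_sum_nth c us ss i) -/f f0 mcoeff0 //.
  have [m fm] := initial_exists f0.
  have: m \in s.
    apply: contraTT (proj1 fm) => ms; rewrite mcoeff_msupp negbK /f raddf_sum big1 //= => j _.
    rewrite mcoeffZ mcoeffX; case: eqP => [e|_]; last by rewrite mulr0.
    by move: ms; rewrite -e mem_nth // ss.
  by rewrite sP => /andP[/asbP[]]; exists f.
exists (fun i => q@_(nth 0%MM s i)).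
suff <- : q = \sum_(i < cnt t P) q@_(nth 0%MM s i) *: 'X_[nth 0%MM s i] by [].
apply/mpolyP => m; case: (boolP (m \in s)) => ms.
  have mi : (index m s < cnt t P)%N by rewrite -ss index_mem.
  have := coeff_sum_nth (fun i : 'I_(cnt t P) => q@_(nth 0%MM s i)) us ss (Ordinal mi).
  by rewrite /= nth_index.
rewrite raddf_sum big1 /= => [|j _].
  apply: contraNeq ms; rewrite -mcoeff_msupp => mq; rewrite sP (dhomog_mf hq mq) eqxx andbT.
  by apply/asbP; apply: sq.
rewrite mcoeffZ mcoeffX; case: eqP => [e|_]; last by rewrite mulr0.
by move: ms; rewrite -e mem_nth // ss.
Qed.

End GradedIdeal.

Definition coef_mx (s : seq 'X_{1..n}) r (f : 'I_r -> R) : 'M[K]_(r, size s) :=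
  \matrix_(i, j) (f i)@_(nth 0%MM s j).

Definition rank_ge (V : R -> Prop) t (C : pred 'X_{1..n}) r : Prop :=
  exists2 f : 'I_r -> R, (forall i, V (f i)) & row_free (coef_mx (filter C (mons n t)) f).

Definition revlex_up t (C : pred 'X_{1..n}) : Prop :=
  forall u v, mdeg u = t -> mdeg v = t -> C u -> revlex_gt v u -> C v.

(** With fewer than [r] leading monomials in [C], some combination of the [f i] vanishes at all of
    them but not on all of [C]. Since [C] is closed under larger monomials, the initial monomial of
    its part of degree [t] lies in [C], a contradiction. *)
Lemma rank_ge_lead L t C r : graded_ideal L -> revlex_up t C -> rank_ge L t C r ->
  (r <= cnt t (fun m => C m && asb (lead L m)))%N.
Proof.
move=> gL upC [f Lf free]; have iL := proj1 gL.
set Q := fun m => _; pose s := filter Q (mons n t).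
rewrite leqNgt; apply/negP => lt.
have ss : size s = cnt t Q by rewrite size_filter.
have [u u0 us] : exists2 u : 'rV_r, u != 0 & u *m coef_mx s f = 0.
  have : kermx (coef_mx s f) != 0.
    rewrite kermx_eq0; apply/negP => /eqP e.
    by have := rank_leq_col (coef_mx s f); rewrite e ss leqNgt lt.
  by case/rowV0Pn => u /sub_kermxP us u0; exists u.
pose g := \sum_i u 0 i *: f i.
have coefg (s' : seq 'X_{1..n}) (j : 'I_(size s')) :
    (u *m coef_mx s' f) 0 j = g@_(nth 0%MM s' j).
  by rewrite mxE raddf_sum /=; apply: eq_bigr => i _; rewrite !mxE mcoeffZ.
have Lg : L g by apply: ideal_sum => // i _; apply: idealZ.
have [c [cC ct gc]] : exists c, [/\ C c, mdeg c = t & g@_c != 0].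
  have : u *m coef_mx (filter C (mons n t)) f != 0.
    by rewrite mulmx_free_eq0.
  move=> ne; have [j nj] : exists j, (u *m coef_mx (filter C (mons n t)) f) 0 j != 0.
    apply/existsP; apply: contraNT ne; rewrite negb_exists => /forallP al.
    by apply/eqP/rowP => j; have := al j; rewrite negbK => /eqP ->; rewrite mxE.
  have := mem_nth 0%MM (ltn_ord j); rewrite mem_filter_mons => /andP[Cj /eqP dj].
  by exists (nth 0%MM (filter C (mons n t)) j); rewrite -coefg.
pose g' := pihomog mdeg t g.
have g'c : c \in msupp g' by rewrite mcoeff_msupp mcoeff_pihomog ct eqxx.
have g'0 : g' != 0 by apply: contraTneq g'c => ->; rewrite msupp0.
have [m [mg' mmax]] := initial_exists g'0.
have Lg' : L g' by apply: (proj2 gL).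
have mt : mdeg m = t.
  by move: mg'; rewrite mcoeff_msupp mcoeff_pihomog; case: ifP => [/eqP //|_]; rewrite eqxx.
have Cm : C m.
  case: (eqVneq c m) => [<- //|ne]; apply: (upC c) => //; exact: mmax.
have ms : m \in s.
  by rewrite mem_filter_mons mt eqxx andbT /Q Cm; apply/asbP; exists g'.
have mi : (index m s < size s)%N by rewrite index_mem.
have := coefg s (Ordinal mi); rewrite us mxE /= nth_index // => e.
by move: mg'; rewrite mcoeff_msupp mcoeff_pihomog mt eqxx -e eqxx.
Qed.

(** The image of [V] among the coefficient vectors on [C] has codimension at most [N]. *)
Definition codim_le (V : R -> Prop) t (C : pred 'X_{1..n}) N : Prop :=
  exists e : 'I_N -> R, forall p, p \is t.-homog ->
    exists c : 'I_N -> K, exists2 f, V f &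
      forall m, mdeg m = t -> C m -> (p - \sum_i c i *: e i - f)@_m = 0.

Lemma codim_rank (V : R -> Prop) t C N : V 0 ->
  (forall (a : K) u v, V u -> V v -> V (a *: u + v)) ->
  codim_le V t C N -> rank_ge V t C (cnt t C - N).
Proof.
move=> V0 VL [e eP]; pose s := filter C (mons n t).
have -> : cnt t C = size s by rewrite size_filter.
pose co (p : R) : 'rV_(size s) := \row_j p@_(nth 0%MM s j).
have us : uniq s := filter_uniq _ (uniq_mons _ _).
have sP (j : 'I_(size s)) : C (nth 0%MM s j) /\ mdeg (nth 0%MM s j) = t.
  by have := mem_nth 0%MM (ltn_ord j); rewrite mem_filter_mons => /andP[? /eqP ?].
have [||v|F fF PF] := @codim_rows K N (size s) (fun v => exists2 f, V f & v = co f)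
   (coef_mx s e).
- by exists 0 => //; apply/rowP => j; rewrite !mxE mcoeff0.
- move=> a _ _ [f Vf ->] [g Vg ->]; exists (a *: f + g); first exact: VL.
  by apply/rowP => j; rewrite !mxE mcoeffD mcoeffZ.
- pose p := \sum_j v 0 j *: ('X_[nth 0%MM s j] : R).
  have hp : p \is t.-homog.
    by apply: rpred_sum => j _; apply: rpredZ; rewrite dhomogX; apply/eqP; have [] := sP j.
  have [c [f Vf pf]] := eP p hp; exists (\row_i c i); exists f => //.
  apply/rowP => j; have [Cj tj] := sP j; have := pf _ tj Cj.
  rewrite !mcoeffB coeff_sum_nth // => /eqP; rewrite subr_eq0 => /eqP e0.
  rewrite [RHS]mxE -e0.
  rewrite !mxE; congr (_ - _); rewrite raddf_sum /=; apply: eq_bigr => i _.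
  by rewrite !mxE mcoeffZ.
have [f Vf fP] := fin_all_exists2 PF; exists f => //.
suff -> : coef_mx s f = F by [].
by apply/row_matrixP => i; rewrite fP; apply/rowP => j; rewrite !mxE.
Qed.

End Leads.

(** * The strong Lefschetz property and Hilbert functions *)

Section Lefschetz.
Context (n : nat) (K : fieldType).
Local Notation R := {mpoly K[n]}.
Implicit Types (I J S : R -> Prop) (p q f l : R).

Definition comb d (v : 'rV[K]_d) (b : 'I_d -> R) : R := \sum_i v 0 i *: b i.

Lemma combD d (u v : 'rV_d) b : comb (u + v) b = comb u b + comb v b.
Proof. by rewrite -big_split; apply: eq_bigr => i _; rewrite mxE scalerDl. Qed.

Lemma combN d (v : 'rV_d) b : comb (- v) b = - comb v b.
Proof. by rewrite -sumrN; apply: eq_bigr => i _; rewrite mxE scaleNr. Qed.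

Lemma comb_homog d (v : 'rV_d) b t : (forall i, b i \is t.-homog) -> comb v b \is t.-homog.
Proof. by move=> hb; apply: rpred_sum => i _; apply: rpredZ. Qed.

Lemma comb_mul d d' (v : 'rV_d) (C : 'M_(d, d')) (b : 'I_d' -> R) :
  comb (v *m C) b = comb v (fun i => comb (row i C) b).
Proof.
rewrite /comb; under [RHS]eq_bigr do rewrite scaler_sumr.
rewrite exchange_big; apply: eq_bigr => j _; rewrite mxE scaler_suml.
by apply: eq_bigr => i _; rewrite mxE scalerA.
Qed.

Lemma comb_congr I d (v : 'rV_d) (b b' : 'I_d -> R) : is_ideal I ->
  (forall i, I (b i - b' i)) -> I (comb v b - comb v b').
Proof.
move=> II bb'; rewrite -sumrB; apply: ideal_sum => // i _.
by rewrite -scalerBr; apply: idealZ.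
Qed.

Lemma rowE d (c : 'I_d -> K) (b : 'I_d -> R) : \sum_i c i *: b i = comb (\row_i c i) b.
Proof. by apply: eq_bigr => i _; rewrite mxE. Qed.

Lemma dim_componentE I t d : dim_component I t d <->
  exists b : 'I_d -> R, [/\ forall i, b i \is t.-homog,
    forall v, I (comb v b) -> v = 0 &
    forall p, p \is t.-homog -> exists v, I (p - comb v b)].
Proof.
split=> -[b [hb fb sb]]; exists b; split=> //.
- by move=> v Iv; apply/rowP => i; rewrite mxE; apply: (fb (fun i => v 0 i)).
- by move=> p /sb [c Ic]; exists (\row_i c i); rewrite -rowE.
- by move=> c; rewrite rowE => /fb /rowP e i; have := e i; rewrite !mxE.
- by move=> p /sb [v Iv]; exists (fun i => v 0 i).
Qed.

Lemma idealBB I p q r : is_ideal I -> I (p - q) -> I (q - r) -> I (p - r).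
Proof. by move=> II pq qr; rewrite -(subrK q p) -addrA; apply: idealD. Qed.

Definition sumI I l : R -> Prop := fun p => exists f q, I f /\ p = f + l * q.

Lemma sumI_ideal I l : is_ideal I -> is_ideal (sumI I l).
Proof.
move=> II; split.
- by exists 0, 0; rewrite mulr0 addr0; split=> //; apply: ideal0.
- move=> _ _ [f [q [If ->]]] [f' [q' [If' ->]]]; exists (f + f'), (q + q').
  by split; [apply: idealD | rewrite mulrDr addrACA].
- move=> g _ [f [q [If ->]]]; exists (g * f), (g * q).
  by split; [apply: idealM | rewrite mulrDr mulrCA].
Qed.

Lemma sub_sumI I l p : I p -> sumI I l p.
Proof. by move=> Ip; exists p, 0; rewrite mulr0 addr0. Qed.

Lemma sumI_r I l q : is_ideal I -> sumI I l (l * q).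
Proof. by move=> II; exists 0, q; rewrite add0r; split=> //; apply: ideal0. Qed.

Lemma pihomogM d e l q : l \is d.-homog ->
  pihomog mdeg e (l * q) = if (d <= e)%N then l * pihomog mdeg (e - d) q else 0.
Proof.
move=> hl; rewrite {1}(pihomog_partitionE (mf := mdeg) (leqnn (msize q))) mulr_sumr linear_sum /=.
have hk k : l * pihomog mdeg k q \is (d + k).-homog by apply: dhomogM => //; apply: pihomogP.
case: leqP => de; last first.
  rewrite big1 // => k _; apply: (pihomog_ne0 (d := (d + k)%N)) => //.
  by apply: contraTneq de => <-; rewrite -leqNgt leq_addr.
case: (ltnP (e - d) (msize q)) => lt.
  rewrite (bigD1 (Ordinal lt)) //= big1 ?addr0 => [|k kne].
    by rewrite pihomog_dE //; have := hk (e - d)%N; rewrite subnKC.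
  apply: (pihomog_ne0 (d := (d + k)%N)) => //.
  by apply: contraNneq kne => e'; apply/eqP/val_inj; rewrite /= -e' addKn.
rewrite big1 => [|k _]; last first.
  apply: (pihomog_ne0 (d := (d + k)%N)) => //.
  by apply: contraTneq lt => e'; rewrite -ltnNge -e' addKn.
apply/esym; rewrite (_ : pihomog _ _ _ = 0) ?mulr0 //.
apply/mpolyP => m; rewrite mcoeff_pihomog mcoeff0; case: eqP => // md.
by apply/memN_msupp_eq0/msize_mdeg_ge; rewrite md.
Qed.

Lemma sumI_graded I l d : graded_ideal I -> l \is d.-homog -> graded_ideal (sumI I l).
Proof.
move=> [II gI] hl; split; first exact: sumI_ideal.
move=> _ e [f [q [If ->]]]; rewrite pihomogD (pihomogM _ _ hl).
exists (pihomog mdeg e f), (if (d <= e)%N then pihomog mdeg (e - d) q else 0).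
by split; [apply: gI | case: ifP; rewrite ?mulr0].
Qed.

Section Multiplication.
Context (I : R -> Prop) (l : R) (gI : graded_ideal I) (hl : l \is 1.-homog).
Let II := proj1 gI.

Lemma powl_homog s : l ^+ s \is s.-homog.
Proof. by have := dhomogMn s hl; rewrite mul1n. Qed.

Lemma mult_matrix i s d d' (b : 'I_d -> R) (b' : 'I_d' -> R) :
  (forall j, b j \is i.-homog) ->
  (forall p, p \is (i + s).-homog -> exists v, I (p - comb v b')) ->
  exists C : 'M_(d, d'), forall v, I (l ^+ s * comb v b - comb (v *m C) b').
Proof.
move=> hb sb'.
have hlb j : l ^+ s * b j \is (i + s).-homog.
  by rewrite addnC; apply: dhomogM => //; apply: powl_homog.
have [C CP] := fin_all_exists (fun j => sb' _ (hlb j)).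
exists (\matrix_j C j) => v; rewrite comb_mul /comb mulr_sumr.
rewrite (eq_bigr (fun j => v 0 j *: (l ^+ s * b j))) => [|j _]; last by rewrite scalerAr.
by apply: comb_congr => // j; rewrite rowK.
Qed.

(** Injectivity makes the matrix [C] of the multiplication row free; the rows [W] completing it to
    an invertible matrix represent a basis of the cokernel. *)
Lemma dim_coker_inj i s d k : dim_component I i d -> dim_component I (i + s) (d + k) ->
  mult_injective I l i s -> dim_component (sumI I (l ^+ s)) (i + s) k.
Proof.
move=> /dim_componentE[b [hb fb sb]] /dim_componentE[b' [hb' fb' sb']] inj.
have [C CP] := mult_matrix hb sb'.
have fC : row_free C.
  apply/inj_row_free => v vC; apply: fb; apply: inj; first exact: comb_homog.
  apply: (idealBl II (CP v)); rewrite vC /comb; apply: ideal_sum => // j _.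
  by rewrite mxE scale0r; apply: ideal0.
have [W uW] := row_free_completion fC.
apply/dim_componentE; exists (fun m => comb (row m W) b'); split.
- by move=> m; apply: comb_homog.
- move=> c [f [q [If e]]].
  have hc : comb c (fun m => comb (row m W) b') \is (i + s).-homog.
    by apply: comb_homog => m; apply: comb_homog.
  have := pihomog_dE hc; rewrite {1}e pihomogD (pihomogM _ _ (powl_homog s)).
  rewrite leq_addl addnK; set q' := pihomog _ _ q => e'.
  have [v Iv] := sb q' (pihomogP _ _ _).
  have : I (comb (c *m W - v *m C) b').
    rewrite combD combN comb_mul -e'.
    rewrite (_ : _ + _ - _ = pihomog mdeg (i + s) f + (l ^+ s * (q' - comb v b)
      + (l ^+ s * comb v b - comb (v *m C) b'))); last first.
      by rewrite -addrA mulrBr; congr (_ + _); rewrite addrA subrK.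
    by apply: idealD => //; [apply: (proj2 gI) | apply: idealD => //; apply: idealM].
  move/fb' => e0.
  have : row_mx (- v) c *m col_mx C W = 0 by rewrite mul_row_col mulNmx addrC.
  move/(congr1 (fun A => A *m invmx (col_mx C W))); rewrite mulmxK // mul0mx.
  by rewrite -row_mx0 => /eq_row_mx[].
move=> p hp; have [u Iu] := sb' p hp.
pose w := u *m invmx (col_mx C W); exists (rsubmx w).
have eu : u = lsubmx w *m C + rsubmx w *m W.
  by rewrite -mul_row_col hsubmxK mulmxKV.
rewrite -comb_mul.
exists ((p - comb u b') - (l ^+ s * comb (lsubmx w) b - comb (lsubmx w *m C) b')).
exists (comb (lsubmx w) b); split; first by apply: idealB.
rewrite eu combD; set x := comb _ b'; set y := comb _ b'; set z := l ^+ s * _.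
by rewrite opprB addrA subrK opprD addrA [_ + y]addrAC subrK.
Qed.

Lemma mult_injective_leq i s d d' : dim_component I i d -> dim_component I (i + s) d' ->
  mult_injective I l i s -> (d <= d')%N.
Proof.
move=> /dim_componentE[b [hb fb sb]] /dim_componentE[b' [hb' fb' sb']] inj.
have [C CP] := mult_matrix hb sb'.
have fC : row_free C.
  apply/inj_row_free => v vC; apply: fb; apply: inj; first exact: comb_homog.
  apply: (idealBl II (CP v)); rewrite vC /comb; apply: ideal_sum => // j _.
  by rewrite mxE scale0r; apply: ideal0.
by rewrite -(eqP fC) rank_leq_col.
Qed.

Lemma mult_surjective_leq i s d d' : dim_component I i d -> dim_component I (i + s) d' ->
  mult_surjective I l i s -> (d' <= d)%N.
Proof.
move=> /dim_componentE[b [hb fb sb]] /dim_componentE[b' [hb' fb' sb']] sur.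
have [C CP] := mult_matrix hb sb'.
have ex j : exists v, I (b' j - comb (v *m C) b').
  have [p hp Ip] := sur _ (hb' j); have [v Iv] := sb p hp; exists v.
  apply: (idealBB II Ip); rewrite -(subrK (l ^+ s * comb v b) (l ^+ s * p)) -addrA.
  by apply: idealD => //; rewrite -mulrBr; apply: idealM.
have [A AP] := fin_all_exists ex.
have AC : (\matrix_j A j) *m C = 1%:M.
  apply/row_matrixP => j; rewrite row_mul rowK; apply/eqP; rewrite -subr_eq0; apply/eqP.
  apply: fb'; rewrite combD combN -opprB; apply: idealN => //.
  suff -> : comb (row j 1%:M) b' = b' j by [].
  rewrite /comb (bigD1 j) //= big1 ?addr0 => [|m mj]; rewrite !mxE ?eqxx ?scale1r //.
  by rewrite eq_sym (negbTE mj) scale0r.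
by rewrite -[d'](mxrank1 K) -AC; apply: leq_trans (mxrankM_maxl _ _) (rank_leq_col _).
Qed.

Lemma dim_sumI (a : nat -> nat) s t : hilbert_function I a -> SLP I l ->
  dim_component (sumI I (l ^+ s)) t (hdiff a s t).
Proof.
move=> Ia slp; rewrite /hdiff; case: leqP => st; last first.
  rewrite subn0; have [b [hb fb sb]] := Ia t; exists b; split=> // [c|p /sb [c Ic]].
    case=> f [q [If e]]; apply: fb.
    have hc : \sum_(i < a t) c i *: b i \is t.-homog.
      by apply: rpred_sum => i _; apply: rpredZ.
    rewrite -(pihomog_dE hc) e pihomogD (pihomogM _ _ (powl_homog s)) leqNgt st /= addr0.
    exact: (proj2 gI).
  by exists c; apply: sub_sumI.
have [t' et] : exists t', t = (t' + s)%N by exists (t - s)%N; rewrite subnK.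
rewrite {}et addnK {t st}.
have sur0 : mult_surjective I l t' s -> dim_component (sumI I (l ^+ s)) (t' + s) 0.
  move=> sur; exists (fun=> 0); split=> [i|c _ i|p hp]; [by case: i|by case: i|].
  exists (fun=> 0); rewrite big_ord0 subr0; have [q hq Iq] := sur p hp.
  by exists (p - l ^+ s * q), q; rewrite subrK.
have sur : mult_surjective I l t' s -> dim_component (sumI I (l ^+ s)) (t' + s) (a (t' + s)%N - a t')%N.
  move=> sur; have := mult_surjective_leq (Ia t') (Ia (t' + s)%N) sur.
  by rewrite -subn_eq0 => /eqP ->; apply: sur0.
(* [SLP] speaks of positive [s] only; for [s = 0] multiplication by 1 is surjective. *)
case: s sur {sur0} => [|s] sur.
  apply: sur => q; rewrite addn0 => hq; exists q => //.
  by rewrite expr0 mul1r subrr; apply: ideal0.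
case: (slp t' s.+1 isT) => [inj|]; last exact: sur.
have le := mult_injective_leq (Ia t') (Ia (t' + s.+1)%N) inj.
apply: (dim_coker_inj (Ia t')) => //; rewrite subnKC //.
Qed.

End Multiplication.

Section Flags.
Context (k : nat).
Implicit Types (g : 'I_k -> R).

Definition flag I g (i : nat) : R -> Prop :=
  ideal_gen (fun p => I p \/ exists2 j : 'I_k, (j < i)%N & p = g j).

Lemma flag_ideal I g i : is_ideal (flag I g i).
Proof. exact: ideal_gen_ideal. Qed.

Lemma sub_flag I g i p : I p -> flag I g i p.
Proof. by move=> Ip; apply: ideal_genW; left. Qed.

Lemma flag_gen I g i (j : 'I_k) : (j < i)%N -> flag I g i (g j).
Proof. by move=> ji; apply: ideal_genW; right; exists j. Qed.

Lemma flag0 I g : is_ideal I -> same_set (flag I g 0) I.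
Proof.
move=> II p; split; last exact: sub_flag.
by apply: ideal_gen_min => // q [//|[j]].
Qed.

Lemma flag_le I g g' i i' : (i <= i')%N -> (forall j : 'I_k, (j < i)%N -> g j = g' j) ->
  forall p, flag I g i p -> flag I g' i' p.
Proof.
move=> ii' gg'; apply: ideal_gen_min; first exact: flag_ideal.
move=> p [|[j ji ->]]; first exact: sub_flag.
by rewrite gg' //; apply: flag_gen; apply: leq_trans ii'.
Qed.

Lemma flagS I g (i : 'I_k) : same_set (flag I g i.+1) (sumI (flag I g i) (g i)).
Proof.
move=> p; split.
  apply: ideal_gen_min; first exact/sumI_ideal/flag_ideal.
  move=> q [Iq|[j + ->]]; first by apply: sub_sumI; apply: sub_flag.
  rewrite ltnS leq_eqVlt => /orP[/eqP/ord_inj ->|ji]; last by apply: sub_sumI; apply: flag_gen.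
  by rewrite -[X in sumI _ _ X]mulr1; apply: sumI_r; apply: flag_ideal.
case=> f [q [If ->]]; apply: (idealD (flag_ideal I g i.+1)).
  by apply: (flag_le (leqnSn i) _ If).
by rewrite mulrC; apply: (idealM (flag_ideal I g i.+1)); apply: flag_gen.
Qed.

Lemma eq_graded I J : same_set I J -> graded_ideal I -> graded_ideal J.
Proof.
move=> IJ [[I0 ID IM] gI]; split; first split.
- exact/IJ.
- by move=> p q /IJ Ip /IJ Iq; apply/IJ/ID.
- by move=> f p /IJ Ip; apply/IJ/IM.
by move=> p d /IJ Ip; apply/IJ/gI.
Qed.

Lemma flag_graded I g i : graded_ideal I -> (forall j, g j \is 1.-homog) ->
  (i <= k)%N -> graded_ideal (flag I g i).
Proof.
move=> gI hg; elim: i => [|i IH] ik.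
  by apply: (eq_graded _ gI); apply: same_set_sym; apply: flag0; case: gI.
apply: eq_graded (same_set_sym (flagS I g (Ordinal ik))) _.
by apply: sumI_graded (hg _); apply/IH/ltnW.
Qed.

(** [hdiff] with [s = 1] is [Delta], so each form of the flag contributes one difference. *)
Lemma flag_hilbert I g h i : graded_ideal I -> (forall j, g j \is 1.-homog) ->
  (forall j : 'I_k, SLP (flag I g j) (g j)) -> hilbert_function I h ->
  (i <= k)%N -> hilbert_function (flag I g i) (iter i Delta h).
Proof.
move=> gI hg slp Ih; elim: i => [|i IH] ik t.
  by apply: eq_dim_component (Ih t); apply: same_set_sym; apply: flag0; case: gI.
pose io := Ordinal ik.
apply: eq_dim_component (same_set_sym (flagS I g io)) _; rewrite iterS /=.
have := dim_sumI (flag_graded gI hg (ltnW ik)) (hg io) 1 t (IH (ltnW ik)) (slp io).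
by rewrite expr1 /hdiff; case: t => [|t] //=; rewrite ?subn0 // subSS subn0.
Qed.

End Flags.

End Lefschetz.

Lemma unitmx_completion (K : fieldType) n d (U : 'M[K]_(d, n)) : row_free U ->
  exists2 G : 'M_n, G \in unitmx &
    forall (i : 'I_d) (j : 'I_n), i = j :> nat -> row j G = row i U.
Proof.
move=> fU; have dn : (d <= n)%N by rewrite -(eqP fU) rank_leq_col.
have [k e] : exists k, n = (d + k)%N by exists (n - d)%N; rewrite subnKC.
subst n; have [W uW] := row_free_completion fU.
exists (col_mx U W) => // i j ij; apply/rowP => m; rewrite !mxE.
case: splitP => [i' e|i' e]; first by congr (U _ _); apply: ord_inj; rewrite -e.
by have := ltn_ord i; rewrite ij e ltnNge leq_addr.
Qed.

(** * Replacing the Lefschetz forms by linearly independent ones *)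

Section IndependentForms.
Context (n : nat) (K : fieldType).
Local Notation R := {mpoly K[n]}.
Implicit Types (I J S : R -> Prop) (p q f l : R).

Definition linform (v : 'rV[K]_n) : R := \sum_j v 0 j *: 'X_j.

Lemma linform_homog v : linform v \is 1.-homog.
Proof. by apply: rpred_sum => j _; apply: rpredZ; rewrite dhomogX; apply/eqP/mdeg1. Qed.

Lemma linform_comb d (u : 'rV_d) (A : 'M_(d, n)) :
  linform (u *m A) = \sum_i u 0 i *: linform (row i A).
Proof.
rewrite /linform; under [RHS]eq_bigr do rewrite scaler_sumr.
rewrite exchange_big; apply: eq_bigr => j _; rewrite mxE scaler_suml.
by apply: eq_bigr => i _; rewrite mxE scalerA.
Qed.

Lemma homog1_linform p : p \is 1.-homog -> p = linform (\row_j p@_U_(j)).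
Proof.
move=> hp; apply/mpolyP => m; rewrite raddf_sum /=.
case: (boolP (mdeg m == 1%N)) => [/mdeg1P[j /eqP ->]|m1].
  rewrite (bigD1 j) //= big1 ?addr0 => [|i ij]; rewrite mxE mcoeffZ mcoeffX ?eqxx ?mulr1 //.
  by rewrite eq_mnm1 (negbTE ij) mulr0.
rewrite (dhomog_nemf_coeff hp m1) big1 // => j _; rewrite mcoeffZ mcoeffX.
by case: eqP => [e|_]; rewrite ?mulr0 //; rewrite -e mdeg1 in m1.
Qed.

Lemma ideal_variables J : is_ideal J -> (forall j : 'I_n, J 'X_j) ->
  forall t p, p \is t.-homog -> (0 < t)%N -> J p.
Proof.
move=> JI JX t p hp t0; rewrite (mpolyE p) big_seq; apply: ideal_sum => // m mp.
apply: idealZ => //; have mt := dhomog_mf hp mp.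
have [j mj] : exists j, m j != 0%N.
  apply/existsP; rewrite -negb_forall; apply: contraTN t0 => /forallP m0.
  by rewrite -mt /= mdegE big1 // => j _; apply/eqP.
have le : (U_(j) <= m)%MM.
  by apply/mnm_lepP => i; rewrite mnm1E; case: eqP => // <-; rewrite lt0n.
by rewrite -(submK le) mpolyXD; apply: (idealM JI).
Qed.

(** An upper bound for the dimension, which unlike [dim_component] survives enlarging the ideal. *)
Definition span_le I t N : Prop :=
  exists e : 'I_N -> R, forall p, p \is t.-homog -> exists c, I (p - \sum_(i < N) c i *: e i).

Lemma span_leW I J t N : (forall p, I p -> J p) -> span_le I t N -> span_le J t N.
Proof. by move=> IJ [e eP]; exists e => p /eP [c /IJ]; exists c. Qed.

Lemma dim_span I t N : dim_component I t N -> span_le I t N.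
Proof. by case=> b [_ _ sb]; exists b. Qed.

Lemma span_le_all I t N : is_ideal I -> (forall p, p \is t.-homog -> I p) -> span_le I t N.
Proof.
move=> II Ip; exists (fun=> 0) => p /Ip {}Ip; exists (fun=> 0).
by rewrite big1 ?subr0 // => i _; rewrite scaler0.
Qed.

Lemma iter_Delta0 h i : iter i Delta h 0%N = h 0%N.
Proof. by elim: i => // i IH; rewrite iterS. Qed.

(* When some [g i] is a combination of the preceding forms, the Lefschetz property
   forces all linear forms into the ideal at that stage, so that the remaining
   forms may be replaced by arbitrary ones. *)
Lemma independent_forms I h : graded_ideal I -> kSLP n I -> hilbert_function I h ->
  exists2 G : 'M[K]_n, G \in unitmx & forall (i : 'I_n) s t,
    span_le (sumI (flag I (fun j => linform (row j G)) i) (linform (row i G) ^+ s)) t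
      (hdiff (iter i Delta h) s t).
Proof.
move=> gI [g [hg slp]] Ih; have II := proj1 gI.
have Fh i ik := flag_hilbert gI hg slp Ih (i := i) ik.
have Fg i ik := flag_graded gI hg (i := i) ik.
pose C : 'M_n := \matrix_(i, j) (g i)@_U_(j).
have gC i : g i = linform (row i C).
  by rewrite {1}(homog1_linform (hg i)); congr linform; apply/rowP => j; rewrite !mxE.
pose rC (a : nat) : 'rV_n := if insub a is Some o then row o C else 0.
have rCo (o : 'I_n) : rC o = row o C by rewrite /rC valK.
pose M i : 'M_(i, n) := \matrix_(a < i) rC a.
(* The least such index [i0] is that of the first form depending on its predecessors, or [n] if the
   forms are independent. *)
pose dep i := (n <= i)%N || (rC i <= M i)%MS.
have exdep : exists i, dep i by exists n; rewrite /dep leqnn.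
case: (ex_minnP exdep) => i0 dep0 min0.
have i0n : (i0 <= n)%N by apply: min0; rewrite /dep leqnn.
have free i : (i <= i0)%N -> row_free (M i).
  elim: i => [|i IH] ii0; first by rewrite /row_free eqn_leq rank_leq_row.
  apply/inj_row_free => v; rewrite mulmx_sum_row big_ord_recr /= => e.
  have eM : \sum_(a < i) v 0 (widen_ord (leqnSn i) a) *: rC a
      = (\row_(a < i) v 0 (widen_ord (leqnSn i) a)) *m M i.
    by rewrite mulmx_sum_row; apply: eq_bigr => a _; rewrite rowK mxE.
  rewrite (eq_bigr (fun a : 'I_i => v 0 (widen_ord (leqnSn i) a) *: rC a)) in e; last by move=> a _; rewrite rowK.
  rewrite rowK eM in e.
  have v0 : v 0 ord_max = 0.
    apply/eqP; apply: contraT => vn; have : dep i.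
      rewrite /dep; apply/orP; right; rewrite -(eqmx_scale _ vn).
      by move/eqP: e; rewrite addrC addr_eq0 => /eqP ->; rewrite -mulNmx submxMl.
    by move/min0; rewrite leqNgt ii0.
  move: e; rewrite v0 scale0r addr0 => /eqP; rewrite mulmx_free_eq0 ?IH ?(ltnW ii0) // => /eqP/rowP e.
  apply/rowP => a; rewrite mxE; case: (ltnP a i) => ai.
    have := e (Ordinal ai); rewrite !mxE => <-; congr (v 0 _); exact: ord_inj.
  have -> : a = ord_max by apply: ord_inj; apply/eqP; rewrite eqn_leq ai -ltnS ltn_ord.
  exact: v0.
have [G uG GM] := unitmx_completion (free _ (leqnn _)); exists G => // i s t.
set l := fun j => _.
have lg (j : 'I_n) : (j < i0)%N -> g j = l j.
  by move=> ji; rewrite /l (GM (Ordinal ji)) // rowK rCo gC.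
case: (ltnP i i0) => ii0.
  have := dim_span (dim_sumI (Fg i (ltnW (ltn_ord i))) (hg i) s t (Fh i (ltnW (ltn_ord i))) (slp i)).
  apply: span_leW => _ [f [q [If ->]]]; exists f, q; split; last by rewrite lg.
  by apply: (flag_le (leqnn i) _ If) => j ji; apply: lg; apply: ltn_trans ii0.
case: s => [|s].
  apply: span_le_all; first exact/sumI_ideal/flag_ideal.
  by move=> p _; rewrite expr0 -[p]mul1r; apply: sumI_r; apply: flag_ideal.
(* In degree 0 a positive power of a form contributes nothing, and the expected dimension is
   [h 0]. *)
case: t => [|t].
  rewrite /hdiff ltn0 subn0 iter_Delta0; apply: span_leW (dim_span (Ih 0%N)).
  by move=> p Ip; apply: sub_sumI; apply: sub_flag.
have i0n' : (i0 < n)%N by apply: leq_ltn_trans ii0 (ltn_ord i).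
pose o := Ordinal i0n'.
have /submxP[u eu] : (rC i0 <= M i0)%MS by move: dep0; rewrite /dep leqNgt i0n'.
have FI := flag_ideal I g i0.
have Fo : flag I g i0 (g o).
  rewrite gC -rCo eu linform_comb; apply: (ideal_sum FI) => a _; apply: (idealZ FI).
  have an : (a < n)%N := leq_trans (ltn_ord a) i0n.
  have ra : rC a = row (Ordinal an) C by rewrite -rCo.
  by rewrite rowK ra -gC; apply: flag_gen; apply: (ltn_ord a).
(* Multiplication by [g o] is zero modulo the flag, yet of full rank from degree 0 to degree 1: if
   injective, the flag contains 1; if surjective, it contains all linear forms. *)
have F1 q : q \is 1.-homog -> flag I g i0 q.
  move=> hq; case: (slp o 0%N 1%N isT) => [inj|sur].
    rewrite -[q]mulr1; apply: (idealM FI); apply: inj; first exact: dhomog1.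
    by rewrite expr1 mulr1.
  have [p hp Fp] := sur q hq; apply: (idealBl FI Fp).
  by rewrite expr1 mulrC; apply: (idealM FI).
apply: span_le_all; first exact/sumI_ideal/flag_ideal.
move=> p hp; apply: sub_sumI; apply: (flag_le (g := g) ii0 lg).
apply: (ideal_variables FI _ hp) => // j; apply: F1.
by rewrite dhomogX; apply/eqP/mdeg1.
Qed.

End IndependentForms.

(** * Change of coordinates *)

Section Action.
Context (n : nat) (K : fieldType).
Local Notation R := {mpoly K[n]}.
Implicit Types (I J S : R -> Prop) (p q f l : R) (g : 'M[K]_n).

Lemma mx_actD g p q : mx_act g (p + q) = mx_act g p + mx_act g q.
Proof. exact: comp_mpolyD. Qed.

Lemma mx_actB g p q : mx_act g (p - q) = mx_act g p - mx_act g q.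
Proof. exact: comp_mpolyB. Qed.

Lemma mx_actM g p q : mx_act g (p * q) = mx_act g p * mx_act g q.
Proof. exact: rmorphM. Qed.

Lemma mx_actZ g (c : K) p : mx_act g (c *: p) = c *: mx_act g p.
Proof. exact: comp_mpolyZ. Qed.

Lemma mx_act0 g : mx_act g 0 = 0.
Proof. exact: comp_mpoly0. Qed.

Lemma mx_act_sum g (A : Type) (r : seq A) (P : pred A) (F : A -> R) :
  mx_act g (\sum_(i <- r | P i) F i) = \sum_(i <- r | P i) mx_act g (F i).
Proof. exact: raddf_sum. Qed.

Lemma mx_actX g p s : mx_act g (p ^+ s) = mx_act g p ^+ s.
Proof. exact: rmorphXn. Qed.

Lemma mx_act_var g (j : 'I_n) : mx_act g 'X_j = linform (row j g^T).
Proof.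
rewrite /mx_act comp_mpolyXU -tnth_nth tnth_mktuple.
by apply: eq_bigr => i _; rewrite !mxE.
Qed.

Lemma mx_act_linform g (v : 'rV_n) : mx_act g (linform v) = linform (v *m g^T).
Proof.
rewrite linform_comb mx_act_sum; apply: eq_bigr => j _.
by rewrite mx_actZ mx_act_var.
Qed.

Lemma mx_act_mon g m : mx_act g 'X_[m] = \prod_(j < n) linform (row j g^T) ^+ m j.
Proof.
rewrite /mx_act comp_mpolyX; apply: eq_bigr => j _; congr (_ ^+ _).
by rewrite tnth_mktuple; apply: eq_bigr => i _; rewrite !mxE.
Qed.

Lemma mx_actE g p :
  mx_act g p = \sum_(m <- msupp p) p@_m *: \prod_(j < n) linform (row j g^T) ^+ m j.
Proof. by rewrite {1}(mpolyE p) mx_act_sum; apply: eq_bigr => m _; rewrite mx_actZ mx_act_mon. Qed.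

Lemma linform_delta (j : 'I_n) : linform (delta_mx 0 j) = 'X_j :> R.
Proof.
rewrite /linform (bigD1 j) //= big1 ?addr0 => [|i ij]; rewrite mxE eqxx ?eqxx ?scale1r //=.
by rewrite (negbTE ij) scale0r.
Qed.

Lemma mx_act_comp g g' p : mx_act g (mx_act g' p) = mx_act (g *m g') p.
Proof.
rewrite [mx_act g' p]mx_actE mx_act_sum mx_actE; apply: eq_bigr => m _.
rewrite mx_actZ; congr (_ *: _); rewrite /mx_act rmorph_prod -/(mx_act g).
apply: eq_bigr => j _; rewrite rmorphXn; congr (_ ^+ _).
by rewrite -[LHS]/(mx_act g _) mx_act_linform -row_mul trmx_mul.
Qed.

Lemma mx_act1 p : mx_act 1%:M p = p.
Proof.
rewrite mx_actE [RHS]mpolyE; apply: eq_bigr => m _; congr (_ *: _).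
rewrite mpolyXE_id; apply: eq_bigr => j _; congr (_ ^+ _).
by rewrite trmx1 row1 linform_delta.
Qed.

Lemma mx_actK g p : g \in unitmx -> mx_act (invmx g) (mx_act g p) = p.
Proof. by move=> ug; rewrite mx_act_comp mulVmx // mx_act1. Qed.

Lemma mx_actKV g p : g \in unitmx -> mx_act g (mx_act (invmx g) p) = p.
Proof. by move=> ug; rewrite mx_act_comp mulmxV // mx_act1. Qed.

Lemma mx_act_homog g p t : p \is t.-homog -> mx_act g p \is t.-homog.
Proof.
move=> hp; rewrite mx_actE big_seq; apply: rpred_sum => m mp; apply: rpredZ.
have <- : mdeg m = t := dhomog_mf hp mp.
rewrite mdegE; apply: (big_ind2 (fun (x : R) d => x \is d.-homog)) => [|x d y e|j _].
- exact: dhomog1.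
- exact: dhomogM.
- by have := dhomogMn (m j) (linform_homog (row j g^T)); rewrite mul1n.
Qed.

Lemma mx_act_pihomog g p t : pihomog mdeg t (mx_act g p) = mx_act g (pihomog mdeg t p).
Proof.
rewrite {1}(pihomog_partitionE (mf := mdeg) (leq_maxl (msize p) t.+1)) mx_act_sum linear_sum /=.
have tm : (t < maxn (msize p) t.+1)%N by rewrite leq_max ltnSn orbT.
rewrite (bigD1 (Ordinal tm)) //= big1 ?addr0 => [|k kt].
  by rewrite pihomog_dE //; apply/mx_act_homog/pihomogP.
apply: (pihomog_ne0 (d := k)); last by apply/mx_act_homog/pihomogP.
by apply: contraNneq kt => e; apply/eqP/val_inj.
Qed.

Section Transport.
Context (g : 'M[K]_n) (ug : g \in unitmx).

Lemma mx_act_idealE I q : mx_act_ideal g I q <-> I (mx_act (invmx g) q).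
Proof.
split=> [[p Ip ->]|Iq]; first by rewrite mx_actK.
by exists (mx_act (invmx g) q) => //; rewrite mx_actKV.
Qed.

Lemma mx_act_ideal_graded I : graded_ideal I -> graded_ideal (mx_act_ideal g I).
Proof.
move=> [[I0 ID IM] gI]; split; first split.
- by apply/mx_act_idealE; rewrite mx_act0.
- by move=> p q /mx_act_idealE Ip /mx_act_idealE Iq; apply/mx_act_idealE; rewrite mx_actD; apply: ID.
- by move=> f p /mx_act_idealE Ip; apply/mx_act_idealE; rewrite mx_actM; apply: IM.
by move=> p d /mx_act_idealE Ip; apply/mx_act_idealE; rewrite -mx_act_pihomog; apply: gI.
Qed.

Lemma mx_act_dim I t d : dim_component I t d -> dim_component (mx_act_ideal g I) t d.
Proof.
move=> [b [hb fb sb]]; exists (fun i => mx_act g (b i)).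
have actS (c : 'I_d -> K) : \sum_i c i *: mx_act g (b i) = mx_act g (\sum_i c i *: b i).
  by rewrite mx_act_sum; apply: eq_bigr => i _; rewrite mx_actZ.
split=> [i|c|p hp]; first exact: mx_act_homog.
  by rewrite actS => /mx_act_idealE; rewrite mx_actK //; apply: fb.
have [c Ic] := sb _ (mx_act_homog (invmx g) hp); exists c.
by apply/mx_act_idealE; rewrite actS mx_actB mx_actK.
Qed.

End Transport.

Lemma upclosed_prefix (k : 'I_n) s :
  upclosed (fun m : 'X_{1..n} => ~~ (low k.+1 m && (m k < s)%N)).
Proof.
move=> m m'; apply: contra => /andP[/lowP l mk]; apply/andP; split.
  by apply/lowP => i /l; rewrite mnmDE => /eqP; rewrite addn_eq0 => /andP[/eqP].
by apply: leq_ltn_trans mk; rewrite mnmDE leq_addr.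
Qed.

(** [g] sends the [j]-th form to the variable with the reversed index. The forms before [rev_ord k]
    become the variables after [x_k], and the next one becomes [x_k] itself, so all generators added
    to [I] become monomials outside the prefix. A spanning set of the quotient therefore yields one
    for the coefficient vectors on the prefix modulo [g(I)]. *)
Lemma codim_of_flag I (G : 'M[K]_n) (k : 'I_n) s t N :
  is_ideal I -> G \in unitmx ->
  span_le (sumI (flag I (fun j => linform (row j G)) (rev_ord k))
                (linform (row (rev_ord k) G) ^+ s)) t N ->
  let g := (invmx G *m perm_mx (perm (@rev_ord_inj n)))^T in
  codim_le (mx_act_ideal g I) t (fun m => low k.+1 m && (m k < s)%N) N.
Proof.
move=> II uG [e eP] g; set C := fun m => _.
have ug : g \in unitmx by rewrite unitmx_tr unitmx_mul unitmx_inv uG unitmx_perm.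
have gl j : mx_act g (linform (row j G)) = 'X_(rev_ord j).
  rewrite mx_act_linform trmxK -row_mul mulmxA mulmxV // mul1mx.
  have -> : row j (perm_mx (perm (@rev_ord_inj n))) = delta_mx 0 (rev_ord j) :> 'rV[K]_n.
    by apply/rowP => i; rewrite !mxE permE eqxx [i == _]eq_sym.
  exact: linform_delta.
have upM : upclosed (fun m => ~~ C m) by apply: upclosed_prefix.
have MI := supp_in_ideal (K := K) upM.
(* The preimage under [g] of the sum of [g(I)] and the ideal of polynomials with no monomial in
   [C]. *)
pose J x := exists2 u, mx_act_ideal g I u & supp_in (fun m => ~~ C m) (mx_act g x - u).
have JI : is_ideal J.
  split.
  - by exists 0; [apply/mx_act_idealE => //; rewrite mx_act0; apply: (ideal0 II)|
      rewrite mx_act0 subr0; apply: (ideal0 MI)].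
  - move=> p q [u [pu Ipu ->] Mu] [v [pv Ipv ->] Mv]; exists (mx_act g (pu + pv)).
      by exists (pu + pv) => //; apply: (idealD II).
    by rewrite !mx_actD opprD addrACA; apply: (idealD MI).
  - move=> f p [u [pu Ipu ->] Mu]; exists (mx_act g (f * pu)).
      by exists (f * pu) => //; apply: (idealM II).
    by rewrite !mx_actM -mulrBr; apply: (idealM MI).
have Jflag : forall x, flag I (fun j => linform (row j G)) (rev_ord k) x -> J x.
  apply: ideal_gen_min => // x [Ix|[j jk ->]].
    by exists (mx_act g x); [exists x | rewrite subrr; apply: (ideal0 MI)].
  exists 0; first by exists 0; rewrite ?mx_act0 //; apply: (ideal0 II).
  rewrite subr0 gl; apply/supp_inX; rewrite /C; apply/negP => /andP[/lowP l _].
  have : (k < rev_ord j)%N by move: jk; rewrite /=; have := ltn_ord k; have := ltn_ord j; lia.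
  by move/l; rewrite mnm1E eqxx.
have Jpow q : J (linform (row (rev_ord k) G) ^+ s * q).
  exists 0; first by exists 0; rewrite ?mx_act0 //; apply: (ideal0 II).
  rewrite subr0 mx_actM mx_actX gl rev_ordK mulrC; apply: (idealM MI).
  rewrite mpolyXn; apply/supp_inX; rewrite /C; apply/negP => /andP[_].
  by rewrite mulmnE mnm1E eqxx mul1n ltnn.
exists (fun i => mx_act g (e i)) => p hp.
have [c [f [q [/Jflag Jf ep]]]] := eP _ (mx_act_homog (invmx g) hp); exists c.
have : J (mx_act (invmx g) p - \sum_i c i *: e i) by rewrite ep; apply: (idealD JI).
case=> u Iu; rewrite mx_actB mx_actKV // mx_act_sum.
rewrite (eq_bigr (fun i => c i *: mx_act g (e i))) => [|i _]; last by rewrite mx_actZ.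
move=> Mu; exists u => // m mt Cm; apply/eqP; apply: contraT.
by rewrite -mcoeff_msupp => /Mu; rewrite Cm.
Qed.

End Action.

(** * Open conditions on the matrix entries *)

Section Generic.
Context (n : nat) (K : fieldType).
Local Notation R := {mpoly K[n]}.
Implicit Types (g : 'M[K]_n).

Definition polyfun (f : 'M[K]_n -> K) : Prop :=
  exists Q : {mpoly K[n * n]}, forall g, f g = Q.@[fun k => mxvec g 0 k].

Lemma eq_polyfun f f' : f =1 f' -> polyfun f -> polyfun f'.
Proof. by move=> ff' [Q QP]; exists Q => g; rewrite -ff'. Qed.

Lemma polyfunC c : polyfun (fun=> c).
Proof. by exists c%:MP => g; rewrite mevalC. Qed.

Lemma polyfunD f f' : polyfun f -> polyfun f' -> polyfun (fun g => f g + f' g).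
Proof. by move=> [Q QP] [Q' QP']; exists (Q + Q') => g; rewrite mevalD QP QP'. Qed.

Lemma polyfunM f f' : polyfun f -> polyfun f' -> polyfun (fun g => f g * f' g).
Proof. by move=> [Q QP] [Q' QP']; exists (Q * Q') => g; rewrite mevalM QP QP'. Qed.

Lemma polyfun_entry i j : polyfun (fun g => g i j).
Proof. by exists 'X_(mxvec_index i j) => g; rewrite mevalXU mxvecE. Qed.

Lemma polyfun_sum (A : Type) (r : seq A) (P : pred A) (F : A -> 'M_n -> K) :
  (forall i, polyfun (F i)) -> polyfun (fun g => \sum_(i <- r | P i) F i g).
Proof.
move=> PF; elim: r => [|a r IH].
  by apply: eq_polyfun (polyfunC 0) => g; rewrite big_nil.
case Pa: (P a).
  by apply: eq_polyfun (polyfunD (PF a) IH) => g; rewrite big_cons Pa.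
by apply: eq_polyfun IH => g; rewrite big_cons Pa.
Qed.

Lemma polyfun_prod (A : Type) (r : seq A) (P : pred A) (F : A -> 'M_n -> K) :
  (forall i, polyfun (F i)) -> polyfun (fun g => \prod_(i <- r | P i) F i g).
Proof.
move=> PF; elim: r => [|a r IH].
  by apply: eq_polyfun (polyfunC 1) => g; rewrite big_nil.
case Pa: (P a).
  by apply: eq_polyfun (polyfunM (PF a) IH) => g; rewrite big_cons Pa.
by apply: eq_polyfun IH => g; rewrite big_cons Pa.
Qed.

Lemma polyfun_det d (A : 'M_n -> 'M[K]_d) :
  (forall i j, polyfun (fun g => A g i j)) -> polyfun (fun g => \det (A g)).
Proof.
move=> PA; apply: polyfun_sum => s; apply: polyfunM; first exact: polyfunC.
by apply: polyfun_prod.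
Qed.

Definition polyfam (F : 'M[K]_n -> R) : Prop := forall m, polyfun (fun g => (F g)@_m).

Lemma polyfamC p : polyfam (fun=> p).
Proof. by move=> m; apply: polyfunC. Qed.

Lemma polyfamM F F' : polyfam F -> polyfam F' -> polyfam (fun g => F g * F' g).
Proof.
move=> PF PF' m; apply: eq_polyfun; first by move=> g; rewrite mcoeffM.
by apply: polyfun_sum => k; apply: polyfunM.
Qed.

Lemma polyfam_sum (A : Type) (r : seq A) (P : pred A) (F : A -> 'M_n -> R) :
  (forall i, polyfam (F i)) -> polyfam (fun g => \sum_(i <- r | P i) F i g).
Proof.
move=> PF m; apply: eq_polyfun; first by move=> g; rewrite raddf_sum.
by apply: polyfun_sum => i; apply: PF.
Qed.

Lemma polyfam_mx_act p : polyfam (fun g => mx_act g p).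
Proof.
move=> m; apply: eq_polyfun; first by move=> g; rewrite mx_actE.
move: m; apply: polyfam_sum => m.
have P1 : polyfam (fun g => \prod_(j < n) linform (row j g^T) ^+ m j).
  elim: (index_enum _) => [|j r IH] k.
    by apply: eq_polyfun (polyfamC 1 k) => g; rewrite big_nil.
  apply: (@eq_polyfun (fun g => (linform (row j g^T) ^+ m j
      * \prod_(i <- r) linform (row i g^T) ^+ m i)@_k)); first by move=> g; rewrite big_cons.
  move: k; apply: polyfamM IH; elim: (m j) => [|e IH] k; first exact: (polyfamC 1 k).
  apply: (@eq_polyfun (fun g => (linform (row j g^T) * linform (row j g^T) ^+ e)@_k)).
    by move=> g; rewrite exprS.
  move: k; apply: polyfamM IH; apply: polyfam_sum => i k.
  apply: (@eq_polyfun (fun g => g i j * ('X_i)@_k)); first by move=> g; rewrite mcoeffZ !mxE.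
  by apply: polyfunM; [apply: polyfun_entry | apply: polyfunC].
move=> k; apply: eq_polyfun; first by move=> g; rewrite mcoeffZ.
by apply: polyfunM; [apply: polyfunC | apply: P1].
Qed.

(* A right inverse of the coefficient matrix at [g0] turns full rank into the
   nonvanishing of a determinant. *)
Lemma rank_ge_open (I : R -> Prop) g0 t C r : rank_ge (mx_act_ideal g0 I) t C r ->
  exists Q : {mpoly K[n * n]}, Q.@[fun k => mxvec g0 0 k] != 0 /\
    forall g, Q.@[fun k => mxvec g 0 k] != 0 -> rank_ge (mx_act_ideal g I) t C r.
Proof.
case=> f fI /row_freeP[B fB]; have [b Ib fb] := fin_all_exists2 fI.
set s := filter _ _ in B fB.
have [Q QP] : polyfun (fun g => \det (coef_mx s (fun i => mx_act g (b i)) *m B)).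
  apply: polyfun_det => i j; apply: eq_polyfun; first by move=> g; rewrite mxE.
  apply: polyfun_sum => m; apply: polyfunM; last exact: polyfunC.
  apply: eq_polyfun; first by move=> g; rewrite mxE.
  exact: polyfam_mx_act.
exists Q; split.
  rewrite -QP (_ : coef_mx s _ = coef_mx s f) ?fB ?det1 ?oner_eq0 //.
  by apply/matrixP => i j; rewrite !mxE -fb.
move=> g; rewrite -QP => dn; exists (fun i => mx_act g (b i)); first by move=> i; exists (b i).
have uB : coef_mx s (fun i => mx_act g (b i)) *m B \in unitmx by rewrite unitmxE unitfE.
apply/row_freeP; exists (B *m invmx (coef_mx s (fun i => mx_act g (b i)) *m B)).
by rewrite mulmxA mulmxV.
Qed.

End Generic.

Section Dense.
Context (N : nat) (K : fieldType) (char0 : [pchar K] =i pred0).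

Lemma natr_inj : injective (fun i : nat => i%:R : K).
Proof.
move=> i j; wlog ij : i j / (i <= j)%N.
  by move=> H e; case: (leqP i j) => [ij|/ltnW ij]; [apply: H | apply/esym/H].
move=> /= e; apply/eqP; rewrite eqn_leq ij -subn_eq0.
have /pcharf0P <- := char0; by rewrite natrB // e subrr eqxx.
Qed.

Lemma poly_nonroot (q : {poly K}) : q != 0 -> exists a, q.[a] != 0.
Proof.
move=> q0; apply: NNPP => no.
have : (size [seq i%:R : K | i <- iota 0 (size q)] < size q)%N.
  apply: max_poly_roots => //; last by rewrite map_inj_uniq ?iota_uniq //; apply: natr_inj.
  by apply/allP => a _; apply: contraT => na; case: no; exists a.
by rewrite size_map size_iota ltnn.
Qed.

Lemma meval_line (Q : {mpoly K[N]}) (u v : 'I_N -> K) (z : K) :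
  (mmap polyC (fun k => (u k)%:P + 'X * (v k)%:P) Q).[z] = Q.@[fun k => u k + z * v k].
Proof.
rewrite mevalE /mmap horner_sum; apply: eq_bigr => m _.
rewrite hornerM hornerC /mmap1 horner_prod; congr (_ * _); apply: eq_bigr => i _.
by rewrite horner_exp hornerD hornerC hornerM hornerX hornerC.
Qed.

(** Restricted to the line through [u] and [u'], one polynomial is nonzero at parameter 0 and the
    other at parameter 1; their product is a nonzero univariate polynomial and has a non-root. *)
Lemma nonvanishing_meet (Q Q' : {mpoly K[N]}) (u u' : 'I_N -> K) :
  Q.@[u] != 0 -> Q'.@[u'] != 0 -> exists w, Q.@[w] != 0 /\ Q'.@[w] != 0.
Proof.
move=> Qu Qu'; pose v k := u' k - u k.
pose q (P : {mpoly K[N]}) := mmap polyC (fun k => (u k)%:P + 'X * (v k)%:P) P.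
have [|a] := @poly_nonroot (q Q * q Q').
  rewrite mulf_neq0 //.
    apply: contraNneq Qu => q0; have := meval_line Q u v 0; rewrite -/(q Q) q0 horner0.
    by move=> ->; apply/eqP/meval_eq => k; rewrite mul0r addr0.
  apply: contraNneq Qu' => q0; have := meval_line Q' u v 1; rewrite -/(q Q') q0 horner0.
  by move=> ->; apply/eqP/meval_eq => k; rewrite mul1r addrC subrK.
rewrite hornerM mulf_eq0 negb_or !meval_line => /andP[a1 a2].
by exists (fun k => u k + a * v k).
Qed.

End Dense.

(** * Wronskians *)

Section Wronskian.
Context (K : fieldType) (char0 : [pchar K] =i pred0).
Implicit Types (f q : {poly K}).

(** Unlike the derivative, this operator does not lower the order of vanishing at the origin, so
    ['X^e] can be factored out of a whole row of the Wronskian matrix. *)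
Definition euler f : {poly K} := 'X * f^`().

Lemma iter_euler_sum r (c : 'I_r -> K) (F : 'I_r -> {poly K}) k :
  iter k euler (\sum_i c i *: F i) = \sum_i c i *: iter k euler (F i).
Proof.
elim: k => // k IH; rewrite iterS IH /euler raddf_sum mulr_sumr.
by apply: eq_bigr => i _; rewrite /= derivZ scalerAr.
Qed.

(* The Euler operator acts on the lowest term [c 'X^e] as multiplication by [e]. *)
Lemma iter_euler_Xn e q k :
  exists2 V : {poly K}, iter k euler ('X^e * q) = 'X^e * V & V.[0] = e%:R ^+ k * q.[0].
Proof.
elim: k => [|k [V IH V0]]; first by exists q; rewrite // expr0 mul1r.
exists (V *+ e + 'X * V^`()); last first.
  by rewrite hornerD hornerM hornerX mul0r addr0 hornerMn V0 exprS -mulrA mulr_natl.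
rewrite iterS IH /euler derivM derivXn; case: e {IH V0} => [|e].
  by rewrite !mulr0n mul0r !add0r expr0 !mul1r.
rewrite mulrDr [RHS]mulrDr; congr (_ + _); last by rewrite mulrCA.
by rewrite mulrnAl mulrnAr mulrA -exprS mulrnAr.
Qed.

Lemma euler_dvd (a : K) m f :
  (exists h, f = ('X - a%:P) ^+ m.+1 * h) -> exists h, euler f = ('X - a%:P) ^+ m * h.
Proof.
case=> h ->; exists ('X * (h *+ m.+1 + ('X - a%:P) * h^`())).
rewrite /euler derivM deriv_exp derivXsubC mul1r /= [RHS]mulrCA; congr (_ * _).
by rewrite mulrDr mulrnAl mulrnAr [_ * (_ * h^`())]mulrA -exprSr.
Qed.

Lemma iter_euler_root (a : K) m f k : (k < m)%N ->
  (exists h, f = ('X - a%:P) ^+ m * h) -> (iter k euler f).[a] = 0.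
Proof.
move=> km fm; have : exists h, iter k euler f = ('X - a%:P) ^+ (m - k) * h.
  elim: k km => [|k IH] km; first by rewrite subn0.
  by rewrite iterS; apply: euler_dvd; rewrite subnSK ?(ltnW km) //; apply: IH; apply: ltnW.
case=> h ->; rewrite hornerM horner_exp hornerXsubC subrr expr0n subn_eq0.
by rewrite leqNgt km mul0r.
Qed.

(* Translates of polynomials with distinct orders of vanishing at the origin can be
   prescribed up to order [r]: the Wronskian, formed with the Euler operator, has a
   Vandermonde determinant as lowest coefficient. *)
Lemma generic_translate r (e : 'I_r -> nat) (q : 'I_r -> {poly K}) :
  injective e -> (forall j, (q j).[0] != 0) ->
  exists a : K, forall v : {poly K}, exists c : 'I_r -> K, forall k, (k < r)%N ->
    (\sum_j c j *: (('X^(e j) * q j) \Po ('X + a%:P)))`_k = v`_k.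
Proof.
move=> einj q0; pose Q j := 'X^(e j) * q j.
have [V QV V0] := fin_all_exists2 (fun jk : 'I_r * 'I_r => iter_euler_Xn (e jk.1) (q jk.1) jk.2).
(* At the origin this is a diagonal matrix times a transposed Vandermonde matrix with nodes [e j],
   which are distinct in [K] by characteristic zero. *)
have Vdet : \det (\matrix_(j, k) V (j, k)) != 0.
  apply/eqP => d0; have := congr1 (fun p => p.[0]) d0; rewrite horner0.
  rewrite -[_.[0]]/(horner_eval 0 _) -det_map_mx.
  have -> : map_mx (horner_eval 0) (\matrix_(j, k) V (j, k))
      = diag_mx (\row_j (q j).[0]) *m (Vandermonde r (\row_j (e j)%:R))^T.
    apply/matrixP => j k; rewrite mul_diag_mx !mxE /horner_eval V0 mulrC //.
  rewrite det_mulmx det_diag det_tr det_Vandermonde => /eqP; rewrite mulf_eq0.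
  case/orP => /prodf_eq0[j _]; first by rewrite mxE (negbTE (q0 j)).
  move=> /prodf_eq0[k jk]; rewrite !mxE subr_eq0 => /eqP /(natr_inj char0) /einj e'.
  by rewrite e' ltnn in jk.
have Wdet : \det (\matrix_(j < r, k < r) iter k euler (Q j)) != 0.
  have -> : \matrix_(j, k) iter k euler (Q j)
      = diag_mx (\row_j 'X^(e j)) *m \matrix_(j, k) V (j, k).
    by apply/matrixP => j k; rewrite mul_diag_mx !mxE -(QV (j, k)).
  rewrite det_mulmx mulf_neq0 // det_diag; apply/prodf_neq0 => j _.
  by rewrite mxE expf_neq0 // polyX_eq0.
have [a Wa] := poly_nonroot char0 Wdet; exists a.
pose T := \matrix_(j < r, k < r) (Q j \Po ('X + a%:P))`_k.
have uT : T \in unitmx.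
  (* A combination in the kernel is divisible by [('X - a) ^ r], so its first [r] iterated Euler
     images vanish at [a], against the choice of [a]. *)
  rewrite -row_free_unit; apply/inj_row_free => c cT.
  pose f := \sum_j c 0 j *: Q j.
  have fk k : (k < r)%N -> (f \Po ('X + a%:P))`_k = 0.
    move=> kr; have /rowP/(_ (Ordinal kr)) := cT; rewrite !mxE => H; rewrite -[RHS]H.
    rewrite /f raddf_sum /= coef_sum; apply: eq_bigr => j _.
    by rewrite !mxE /= comp_polyZ coefZ.
  have fr : exists h, f = ('X - a%:P) ^+ r * h.
    exists (drop_poly r (f \Po ('X + a%:P)) \Po ('X - a%:P)).
    have e1 : (f \Po ('X + a%:P)) \Po ('X - a%:P) = f.
      by rewrite -comp_polyA comp_polyD comp_polyX comp_polyC subrK comp_polyXr.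
    rewrite -{1}e1 -[f \Po _ in LHS](poly_take_drop r).
    have -> : take_poly r (f \Po ('X + a%:P)) = 0.
      by apply/polyP => k; rewrite coef_take_poly coef0; case: ltnP => // /fk.
    by rewrite add0r comp_polyM comp_Xn_poly mulrC.
  have cW : c *m map_mx (horner_eval a) (\matrix_(j < r, k < r) iter k euler (Q j)) = 0.
    apply/rowP => k; rewrite !mxE; have := iter_euler_root (ltn_ord k) fr.
    rewrite /f iter_euler_sum horner_sum => e0; rewrite -[RHS]e0.
    by apply: eq_bigr => j _; rewrite !mxE hornerZ.
  have uW : map_mx (horner_eval a) (\matrix_(j < r, k < r) iter k euler (Q j)) \in unitmx.
    by rewrite unitmxE det_map_mx unitfE.
  by rewrite -(mulmxK uW c) cW mul0mx.
move=> v; pose c := (\row_(k < r) v`_k) *m invmx T; exists (fun j => c 0 j) => k kr.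
have : (c *m T) 0 (Ordinal kr) = v`_k by rewrite mulmxKV // mxE.
rewrite mxE coef_sum => <-; apply: eq_bigr => j _; by rewrite coefZ !mxE.
Qed.

End Wronskian.

(** * Exchange in three variables *)

Section Exchange.
Context (n : nat) (K : fieldType) (char0 : [pchar K] =i pred0).
Local Notation R := {mpoly K[n]}.
Implicit Types (I J S L : R -> Prop) (p q f l : R).
Context (i0 i1 i2 : 'I_n).
Hypotheses (e0 : i0 = 0%N :> nat) (e1 : i1 = 1%N :> nat) (e2 : i2 = 2%N :> nat).

Definition slice_var (i : 'I_n) : {poly {poly K}} :=
  if i == i0 then 1 else if i == i1 then 'X%:P else if i == i2 then 'X else 0.

(* Substitutes [x_0 = 1], [x_1 = z], [x_2 = w] and [x_i = 0] for [i > 2]; the slice of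
   index [s] is the coefficient of [w^s], a polynomial in [z]. *)
Definition slices p : {poly {poly K}} := mmap (polyC \o polyC) slice_var p.

Lemma low3_eq m m' : low 3 m -> low 3 m' -> mdeg m = mdeg m' ->
  m i1 = m' i1 -> m i2 = m' i2 -> m = m'.
Proof.
move=> /lowP l /lowP l' d c1 c2.
have n1 : i1 != i0 by rewrite -(inj_eq val_inj) /= e0 e1.
have hi (i : 'I_n) : i != i0 -> m i = m' i.
  move=> ne; case: (ltngtP i 2) => i2'.
  - rewrite (_ : i = i1) //; apply: val_inj; rewrite /= e1.
    by move: ne i2'; rewrite -(inj_eq val_inj) /= e0; clear; lia.
  - by rewrite l ?l'.
  - by rewrite (_ : i = i2) //; apply: val_inj; rewrite /= e2.
apply/mnmP => i; case: (eqVneq i i0) => [->|/hi //].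
have dE w : mdeg w = (w i0 + \sum_(i < n | i != i0) w i)%N by rewrite mdegE (bigD1 i0).
by move/eqP: d; rewrite !dE (eq_bigr _ hi) eqn_add2r => /eqP.
Qed.

Lemma slices_mon m : mmap1 slice_var m = (if low 3 m then 'X^(m i1) else 0)%:P * 'X^(m i2).
Proof.
have n1 : i1 != i0 by rewrite -(inj_eq val_inj) /= e0 e1.
have n2 : (i2 != i0) && (i2 != i1) by rewrite -!(inj_eq val_inj) /= e0 e1 e2.
rewrite /mmap1 (bigD1 i0) //= (bigD1 i1) //= (bigD1 i2) //=.
have [n20 n21] := andP n2.
rewrite {1}/slice_var eqxx expr1n mul1r {1}/slice_var (negbTE n1) eqxx.
rewrite {1}/slice_var (negbTE n20) (negbTE n21) eqxx.
case: (boolP (low 3 m)) => [/lowP l|nl].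
  rewrite polyC_exp big1 ?mulr1 // => i /andP[/andP[a b] c].
  rewrite l ?expr0 //; move: a b c; rewrite -!(inj_eq val_inj) /= e0 e1 e2; clear; lia.
have [i i3 mi] : exists2 i : 'I_n, (3 <= i)%N & m i != 0%N.
  by apply: NNPP => no; move/lowP: nl; apply => i i3; apply: NNPP => mi; apply: no; exists i => //; apply/eqP.
rewrite (bigD1 i) /=; last first.
  by rewrite -!(inj_eq val_inj) /= e0 e1 e2; move: i3; clear; lia.
have -> : slice_var i = 0.
  by rewrite /slice_var -!(inj_eq val_inj) /= e0 e1 e2; move: i3; case: (nat_of_ord i) => [|[|[|]]].
by rewrite expr0n (negbTE mi) !polyC0 !(mul0r, mulr0).
Qed.

Lemma coef_slices p s e : ((slices p)`_s)`_e =
  \sum_(m <- msupp p | [&& low 3 m, m i1 == e & m i2 == s]) p@_m.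
Proof.
rewrite /slices /mmap !coef_sum [RHS]big_mkcond; apply: eq_bigr => m _.
rewrite slices_mon /= coefCM coefCM coefCM coefXn.
rewrite [s == _]eq_sym; case: eqP => _; last by rewrite mulr0 coef0 mulr0 !andbF.
rewrite mulr1 andbT; case: (low 3 m); last by rewrite coef0 mulr0.
by rewrite coefXn [e == _]eq_sym /=; case: eqP; rewrite ?mulr1 ?mulr0.
Qed.

Lemma slices_neq0 p s e : ((slices p)`_s)`_e != 0 ->
  exists m, [/\ m \in msupp p, low 3 m, m i1 = e & m i2 = s].
Proof.
rewrite coef_slices => ne; apply: NNPP => no; move/eqP: ne; apply.
rewrite big_seq_cond big1 // => m /andP[mp /and3P[lm /eqP m1 /eqP m2]].
by case: no; exists m.
Qed.

(** Setting [x_0 = 1] loses nothing in a fixed degree, since the degree determines the exponent of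
    [x_0]. *)
Lemma slices_coef p m t : p \is t.-homog -> mdeg m = t -> low 3 m ->
  p@_m = ((slices p)`_(m i2))`_(m i1).
Proof.
move=> hp mt lm; rewrite coef_slices; case: (boolP (m \in msupp p)) => mp; last first.
  rewrite (memN_msupp_eq0 mp) big_seq_cond big1 // => k /andP[kp /and3P[lk /eqP k1 /eqP k2]].
  by move: mp; rewrite -(low3_eq lk lm) ?kp // mt; apply: (dhomog_mf hp).
rewrite big_mkcond (bigD1_seq m) ?msupp_uniq //= lm !eqxx big_seq_cond big1 ?addr0 //.
move=> k /andP[kp km]; case: ifP => // /and3P[lk /eqP k1 /eqP k2].
by move: km; rewrite (low3_eq lk lm) ?eqxx // mt; apply: (dhomog_mf hp).
Qed.

Definition shear (a : K) : 'M[K]_n := 1%:M + a *: delta_mx i0 i1.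

Lemma shear_unit a : shear a \in unitmx.
Proof.
have n1 : (i1 == i0) = false by rewrite -(inj_eq val_inj) /= e0 e1.
suff /mulmx1_unit[] : shear a *m shear (- a) = 1%:M by [].
rewrite /shear mulmxDl mul1mx mulmxDr mulmx1 -scalemxAl -scalemxAr mul_delta_mx_cond n1.
by rewrite mulr0n !scaler0 addr0 scaleNr addrNK.
Qed.

Lemma slicesM p q : slices (p * q) = slices p * slices q.
Proof. by have [H _] := mmap_is_multiplicative slice_var (polyC \o polyC); apply: H. Qed.

Lemma slicesX p e : slices (p ^+ e) = slices p ^+ e.
Proof.
elim: e => [|e IH]; last by rewrite !exprS slicesM IH.
by have [_ H] := mmap_is_multiplicative slice_var (polyC \o polyC); apply: H.
Qed.

Lemma slices_prod (A : Type) (r : seq A) (F : A -> R) :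
  slices (\prod_(i <- r) F i) = \prod_(i <- r) slices (F i).
Proof.
elim: r => [|j r IH]; last by rewrite !big_cons slicesM IH.
by rewrite !big_nil -[1 in LHS](expr0 1) slicesX expr0.
Qed.

Lemma slices_sum (A : Type) (r : seq A) (P : pred A) (F : A -> R) :
  slices (\sum_(i <- r | P i) F i) = \sum_(i <- r | P i) slices (F i).
Proof. exact: raddf_sum. Qed.

Lemma slicesB p q : slices (p - q) = slices p - slices q.
Proof. exact: raddfB. Qed.

Lemma slicesZ c p : slices (c *: p) = c%:P%:P * slices p.
Proof. exact: mmapZ. Qed.

Lemma slices_linform (v : 'rV_n) : slices (linform v) = \sum_i (v 0 i)%:P%:P * slice_var i.
Proof.
rewrite slices_sum; apply: eq_bigr => i _; rewrite slicesZ.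
by rewrite /slices mmapX mmap1U.
Qed.

(** With [x_0 = 1] the shear is the translation of [z] by [a]; it fixes [w], hence acts on each
    slice separately. *)
Lemma slices_shear a p s :
  (slices (mx_act (shear a) p))`_s = (slices p)`_s \Po ('X + a%:P).
Proof.
pose sh := map_poly (comp_poly ('X + a%:P)).
suff -> : slices (mx_act (shear a) p) = sh (slices p) by rewrite coef_map.
rewrite mx_actE slices_sum [in RHS]/slices /mmap /sh rmorph_sum; apply: eq_bigr => m _.
rewrite slicesZ slices_prod rmorphM /= map_polyC /= comp_polyC.
congr (_ * _); rewrite rmorph_prod; apply: eq_bigr => j _.
rewrite slicesX rmorphXn; congr (_ ^+ _).
have n1 : (i1 == i0) = false by rewrite -(inj_eq val_inj) /= e0 e1.
rewrite slices_linform.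
have -> : \sum_i ((row j (shear a)^T) 0 i)%:P%:P * slice_var i
    = slice_var j + ((j == i1)%:R * a)%:P%:P.
  under eq_bigr => i _ do rewrite !mxE !polyCD mulrDl.
  rewrite big_split /=; congr (_ + _).
    by rewrite (bigD1 j) //= eqxx !polyC1 mul1r big1 ?addr0 // => i ij; rewrite (negbTE ij) !polyC0 mul0r.
  rewrite (bigD1 i0) //= eqxx /= {1}/slice_var eqxx mulr1 big1 ?addr0 => [|i ij].
    by rewrite mulrC.
  by rewrite (negbTE ij) mulr0 !polyC0 mul0r.
rewrite /slice_var; case: (eqVneq j i1) => [->|j1].
  by rewrite n1 /= map_polyC /= comp_polyX polyCD mul1r.
rewrite mul0r !polyC0 addr0; case: ifP => _; first by rewrite rmorph1.
case: ifP => _; last by rewrite raddf0.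
by rewrite /= map_polyX.
Qed.

(* Shearing by a generic multiple moves the [r] leading monomials with [x_2]-exponent
   [s] onto the [r] largest ones. *)
Lemma codim_shear L s T : graded_ideal L ->
  let r := cnt T (fun m => [&& low 3 m, m i2 == s & asb (lead L m)]) in
  exists a, codim_le (mx_act_ideal (shear a) L) T
    (fun m => low 3 m && ((m i2 < s)%N || (m i2 == s) && (m i1 < r)%N))
    (cnt T (fun m => ~~ asb (lead L m) && (low 3 m && (m i2 < s)%N))).
Proof.
move=> gL; set P := fun m => _; set r := cnt T P => /=.
have iL := proj1 gL.
pose S := filter P (mons n T).
have sS : size S = r by rewrite size_filter.
have uS : uniq S := filter_uniq _ (uniq_mons _ _).
have SP (j : 'I_r) : [/\ low 3 (nth 0%MM S j), nth 0%MM S j i2 = s,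
    lead L (nth 0%MM S j) & mdeg (nth 0%MM S j) = T].
  have : nth 0%MM S j \in S by rewrite mem_nth // sS.
  by rewrite mem_filter_mons => /andP[/and3P[? /eqP ? /asbP ?] /eqP ?].
have ex (j : 'I_r) : exists p, [/\ L p, p \is T.-homog & is_initial_monomial p (nth 0%MM S j)].
  by have [_ _ ld <-] := SP j; apply: lead_homog.
have [p pP] := fin_all_exists ex.
pose e (j : 'I_r) := nth 0%MM S j i1.
(* In revlex a larger exponent of [x_2], and for equal ones a larger exponent of [x_1], means a
   smaller monomial. So [p j] has no slice below [s], and its slice [s] has order of vanishing
   [e j]. *)
have low_lt (j : 'I_r) m : m \in msupp (p j) -> low 3 m ->
    (s <= m i2)%N /\ (m i2 = s -> (e j <= m i1)%N).
  have [Lp hp [_ mx]] := pP j; have [lj j2 _ dj] := SP j => mp lm.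
  have mT := dhomog_mf hp mp.
  case: (eqVneq m (nth 0%MM S j)) => [->|/(mx m mp)]; first by rewrite j2.
  case/revlexP; first by rewrite dj.
  move=> i lt al; case: (ltngtP i 2) => i2'.
  - rewrite -(al i2) ?e2 // j2; split=> // _; case: (ltngtP i 1) => i1'.
    + by rewrite /e (al i1) ?e1.
    + by move: i1' i2'; clear; lia.
    + by rewrite /e; have <- : i = i1; [apply: val_inj; rewrite /= e1 | apply: ltnW].
  - by rewrite (lowP _ _ lm) in lt.
  have ei : i = i2 by apply: val_inj; rewrite /= e2.
  by move: lt; rewrite ei j2 => lt; split; [apply: ltnW | move=> e3; rewrite e3 ltnn in lt].
have einj : injective e.
  move=> j j' ej; have [lj j2 _ dj] := SP j; have [lj' j2' _ dj'] := SP j'.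
  have /eqP := low3_eq lj lj' (etrans dj (esym dj')) ej (etrans j2 (esym j2')).
  by rewrite nth_uniq ?sS // => /eqP/ord_inj.
have Q0 (j : 'I_r) s' : (s' < s)%N -> (slices (p j))`_s' = 0.
  move=> lt; apply/polyP => k; rewrite coef0; apply/eqP; apply: contraT => /slices_neq0.
  by case=> m [mp lm _ m2]; have [] := low_lt j m mp lm; rewrite m2 leqNgt lt.
have Qe (j : 'I_r) : exists q : {poly K}, (slices (p j))`_s = 'X^(e j) * q.
  exists (drop_poly (e j) (slices (p j))`_s); rewrite mulrC -[LHS](poly_take_drop (e j)).
  rewrite (_ : take_poly _ _ = 0) ?add0r //; apply/polyP => k; rewrite coef_take_poly coef0.
  case: ltnP => // ke; apply/eqP; apply: contraT => /slices_neq0 [m [mp lm m1 m2]].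
  by have [_ /(_ m2)] := low_lt j m mp lm; rewrite m1 leqNgt ke.
have [q qP] := fin_all_exists Qe.
have q0 (j : 'I_r) : (q j).[0] != 0.
  have [lj j2 _ dj] := SP j; have [_ hp [mp _]] := pP j.
  move: mp; rewrite mcoeff_msupp (slices_coef hp dj lj) j2 qP coefXnM ltnn subnn.
  by rewrite horner_coef0.
have [a aP] := generic_translate char0 einj q0; exists a.
pose S1 := filter (fun m => ~~ asb (lead L m) && (low 3 m && (m i2 < s)%N)) (mons n T).
have sS1 : size S1 = cnt T (fun m => ~~ asb (lead L m) && (low 3 m && (m i2 < s)%N)).
  by rewrite size_filter.
rewrite -sS1.
have uS1 : uniq S1 := filter_uniq _ (uniq_mons _ _).
have ua := shear_unit a.
exists (fun i => mx_act (shear a) 'X_[nth 0%MM S1 i]) => x hx.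
have [y [hy Ly sy]] := reduce_std gL (mx_act_homog (invmx (shear a)) hx).
pose c (i : 'I_(size S1)) := y@_(nth 0%MM S1 i).
(* The terms of the normal form [y] counted by the bound are split off; what remains has no slice
   below [s]. *)
pose z := y - \sum_i c i *: ('X_[nth 0%MM S1 i] : R).
have S1P m : m \in S1 = (~~ asb (lead L m) && (low 3 m && (m i2 < s)%N)) && (mdeg m == T).
  by rewrite mem_filter_mons.
have hz : z \is T.-homog.
  apply: rpredB => //; apply: rpred_sum => i _; apply: rpredZ; rewrite dhomogX.
  by have := mem_nth 0%MM (ltn_ord i); rewrite S1P => /andP[].
have zc m : mdeg m = T -> low 3 m -> (m i2 < s)%N -> z@_m = 0.
  move=> mT lm m2; rewrite mcoeffB; case: (boolP (m \in S1)) => mS.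
    have mi : (index m S1 < size S1)%N by rewrite index_mem.
    have := coeff_sum_nth c uS1 erefl (Ordinal mi).
    by rewrite /= nth_index // => ->; rewrite /c /= nth_index // subrr.
  rewrite raddf_sum [X in _ - X]big1 ?subr0 => [|i _ /=]; last first.
    rewrite mcoeffZ mcoeffX; case: eqP => [ei|_]; last by rewrite mulr0.
    by move: mS; rewrite -ei mem_nth.
  apply/eqP; apply: contraNT mS; rewrite -mcoeff_msupp S1P mT lm m2 eqxx !andbT => my.
  by apply/asbP; apply: sy.
have zs s' : (s' < s)%N -> (slices z)`_s' = 0.
  move=> lt; apply/polyP => k; rewrite coef0; apply/eqP; apply: contraT => /slices_neq0.
  case=> m [mz lm _ m2]; move: (mz); rewrite mcoeff_msupp zc ?eqxx ?m2 //.
  exact: (dhomog_mf hz).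
(* After the shear, slice [s] of [z] is matched in its first [r] coefficients by a combination of
   the [p j], which do not disturb the slices below [s]. *)
have [lam lamP] := aP ((slices z)`_s \Po ('X + a%:P)).
exists c; exists (mx_act (shear a) (mx_act (invmx (shear a)) x - y + \sum_j lam j *: p j)).
  exists (mx_act (invmx (shear a)) x - y + \sum_j lam j *: p j) => //.
  apply: idealD => //; apply: ideal_sum => // j _; apply: idealZ => //.
  by have [] := pP j.
have hp j : p j \is T.-homog by have [] := pP j.
have -> : x - \sum_i c i *: mx_act (shear a) 'X_[nth 0%MM S1 i]
   - mx_act (shear a) (mx_act (invmx (shear a)) x - y + \sum_j lam j *: p j)
   = mx_act (shear a) (z - \sum_j lam j *: p j).
  have -> : \sum_i c i *: mx_act (shear a) 'X_[nth 0%MM S1 i]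
      = mx_act (shear a) (\sum_i c i *: 'X_[nth 0%MM S1 i]).
    by rewrite mx_act_sum; apply: eq_bigr => i _; rewrite mx_actZ.
  by rewrite mx_actD !mx_actB mx_actKV //; ring.
set w := z - _ => m mT /andP[lm m2].
have hw : w \is T.-homog.
  by apply: rpredB hz _; apply: rpred_sum => j _; apply: rpredZ (hp j).
rewrite (slices_coef (mx_act_homog _ hw) mT lm) slices_shear.
have slw s' : (slices w)`_s' = (slices z)`_s' - \sum_j lam j *: (slices (p j))`_s'.
  rewrite /w slicesB coefB slices_sum; congr (_ - _); rewrite coef_sum.
  apply: eq_bigr => j _.
  by rewrite slicesZ coefCM mul_polyC.
rewrite slw; case/orP: m2 => [lt|/andP[/eqP m2 lt]].
  rewrite zs // big1 ?subrr ?comp_poly0 ?coef0 // => j _.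
  by rewrite Q0 // scaler0.
rewrite m2 raddfB /= coefB -lamP //; apply/eqP; rewrite subr_eq0; apply/eqP.
rewrite raddf_sum /= !coef_sum; apply: eq_bigr => j _.
by rewrite comp_polyZ qP.
Qed.

End Exchange.

(** * Generic coordinates *)

Section PrefixCount.
Context (n : nat) (D : pred 'X_{1..n}) (h : nat -> nat).
Hypothesis D_down : forall m m', D (m + m')%MM -> D m.
Hypothesis count_D : forall t, cnt t D = h t.
Hypothesis count_low : forall (k : 'I_n) s t,
  (cnt t (fun m => D m && low k.+1 m && (m k < s)%N)
     <= hdiff (iter (n - k.+1) Delta h) s t)%N.

Lemma leq_mdeg (m : 'X_{1..n}) i : (m i <= mdeg m)%N.
Proof. by rewrite mdegE (bigD1 i) //= leq_addr. Qed.

(** The upper bound is attained: [cnt_low] gives the totals, and at most the total of degree [t - s]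
    is divisible by [x_k ^ s]. For [s > t] the prefix condition is void. *)
Lemma cnt_prefix (k : 'I_n) s t :
  cnt t (fun m => D m && low k.+1 m && (m k < s)%N)
    = hdiff (iter (n - k.+1) Delta h) s t.
Proof.
apply/eqP; rewrite eqn_leq count_low /= /hdiff; have lowE := cnt_low D_down count_D count_low.
case: (leqP s t) => st.
  have := cnt_shift D k st; rewrite lowE //.
  have : (cnt (t - s) (fun m => low k.+1 m && D (m + U_(k) *+ s)%MM)
          <= cnt (t - s) (fun m => D m && low k.+1 m))%N.
    by apply: leq_cnt => m _ /andP[-> /D_down ->].
  by rewrite lowE //; clear; lia.
rewrite subn0 -lowE //; apply: leq_cnt => m mt ->.
by apply: leq_ltn_trans st; rewrite -mt leq_mdeg.
Qed.

(** The size of the slice minus its number of standard monomials, the latter being the difference of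
    two consecutive prefix counts. As it depends on [h] alone, it is the same in all good
    coordinates. *)
Definition nlead_slice (s T : nat) (i2 : 'I_n) : nat :=
  (cnt T (fun m => low 3 m && (m i2 == s))
     - (hdiff (iter (n - 3) Delta h) s.+1 T - hdiff (iter (n - 3) Delta h) s T))%N.

Lemma cnt_lead_slice (i2 : 'I_n) s T : i2 = 2%N :> nat ->
  cnt T (fun m => [&& low 3 m, m i2 == s & ~~ D m]) = nlead_slice s T i2.
Proof.
move=> e2; have := cnt_prefix i2 s T; have := cnt_prefix i2 s.+1 T; rewrite e2 /nlead_slice => <- <-.
have -> : cnt T (fun m => low 3 m && (m i2 == s)) =
    (cnt T (fun m => [&& low 3 m, m i2 == s & ~~ D m])
      + cnt T (fun m => low 3 m && (m i2 == s) && D m))%N.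
  rewrite (cnt_split _ (fun m => low 3 m && (m i2 == s)) D) addnC.
  by congr (_ + _)%N; apply: eq_cnt => m _; rewrite andbA.
have -> : cnt T (fun m => D m && low 3 m && (m i2 < s.+1)%N) =
    (cnt T (fun m => D m && low 3 m && (m i2 < s)%N)
      + cnt T (fun m => low 3 m && (m i2 == s) && D m))%N.
  rewrite (cnt_split _ _ (fun m => m i2 < s)%N); congr (_ + _)%N; apply: eq_cnt => m _.
    by rewrite -!andbA [(_ < s.+1)%N && _]andb_idl // => /ltnW.
  rewrite -leqNgt -andbA ltnS -eqn_leq.
  by case: (D m); case: (low 3 m); rewrite /= ?andbT ?andbF.
by rewrite addKn addnK.
Qed.

End PrefixCount.

Section GenericConditions.
Context (n : nat) (K : fieldType) (char0 : [pchar K] =i pred0).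
Local Notation R := {mpoly K[n]}.
Implicit Types (P : 'M[K]_n -> Prop) (g : 'M[K]_n).

Definition generic P : Prop := exists2 Q : {mpoly K[n * n]},
  (exists v, Q.@[v] != 0) & forall g, Q.@[fun k => mxvec g 0 k] != 0 -> P g.

Lemma genericT : generic (fun=> True).
Proof. by exists 1 => //; exists (fun=> 0); rewrite meval1 oner_eq0. Qed.

Lemma genericI P P' : generic P -> generic P' -> generic (fun g => P g /\ P' g).
Proof.
move=> [Q [v Qv] QP] [Q' [v' Qv'] QP']; exists (Q * Q').
  have [w [Qw Qw']] := nonvanishing_meet char0 Qv Qv'.
  by exists w; rewrite mevalM mulf_neq0.
by move=> g; rewrite mevalM mulf_eq0 negb_or => /andP[/QP ? /QP' ?].
Qed.

Lemma genericW P P' : (forall g, P g -> P' g) -> generic P -> generic P'.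
Proof. by move=> PP' [Q Qv QP]; exists Q => // g /QP /PP'. Qed.

Lemma generic_forall (A : finType) (P : A -> 'M[K]_n -> Prop) :
  (forall a, generic (P a)) -> generic (fun g => forall a, P a g).
Proof.
move=> gP; suff : generic (fun g => forall a, a \in enum A -> P a g).
  by apply: genericW => g H a; apply: H; rewrite mem_enum.
elim: (enum A) => [|a s IH]; first by apply: genericW genericT.
apply: genericW (genericI (gP a) IH) => g [Pa Ps] b.
by rewrite inE => /orP[/eqP ->|/Ps].
Qed.

Lemma generic_unit : generic (fun g => g \in unitmx).
Proof.
have [Q QP] : polyfun (fun g : 'M[K]_n => \det g).
  by apply: polyfun_det => i j; apply: polyfun_entry.
exists Q; last by move=> g; rewrite -QP unitmxE unitfE.
by exists (fun k => mxvec 1%:M 0 k); rewrite -QP det1 oner_eq0.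
Qed.

Lemma generic_ex P : generic P -> exists g, P g.
Proof.
case=> Q [v Qv] QP; exists (vec_mx (\row_k v k)); apply: QP.
by rewrite vec_mxK (meval_eq (v2 := v)) // => k; rewrite mxE.
Qed.

Lemma generic_open P : generic P -> exists2 U, zariski_open_GL U & (exists g, U g) /\ forall g, U g -> P g.
Proof.
case=> Q Qv QP; exists (fun g => g \in unitmx /\ Q.@[fun k => mxvec g 0 k] != 0).
  exists (fun f => f = Q) => g; split=> [[ug Qg]|[ug [_ -> Qg]]]; last by [].
  by split=> //; exists Q.
split; last by move=> g [_ /QP].
by apply: generic_ex; apply: genericI generic_unit _; exists Q.
Qed.

Lemma open_meet (U U' : 'M[K]_n -> Prop) : zariski_open_GL U -> zariski_open_GL U' ->
  (exists g, U g) -> (exists g, U' g) -> exists g, U g /\ U' g.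
Proof.
have gen V : zariski_open_GL V -> (exists g, V g) -> generic V.
  case=> F FV [g /FV[ug [f Ff fg]]].
  apply: (@genericW (fun g => g \in unitmx /\ f.@[fun k => mxvec g 0 k] != 0)).
    by move=> g' [ug' fg']; apply/FV; split=> //; exists f.
  by apply: genericI generic_unit _; exists f => //; exists (fun k => mxvec g 0 k).
by move=> oU oU' eU eU'; apply: generic_ex; apply: genericI; apply: gen.
Qed.

Lemma generic_rank_ge (I : R -> Prop) g0 t C r : rank_ge (mx_act_ideal g0 I) t C r ->
  generic (fun g => rank_ge (mx_act_ideal g I) t C r).
Proof. by move=> /rank_ge_open[Q [Qg QP]]; exists Q => //; exists (fun k => mxvec g0 0 k). Qed.

End GenericConditions.

(** * The initial ideal in good coordinates *)

Section GenericInitialIdeal.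
Context (n : nat) (K : fieldType) (char0 : [pchar K] =i pred0).
Local Notation R := {mpoly K[n]}.
Context (I : R -> Prop) (h : nat -> nat).
Hypotheses (gI : graded_ideal I) (aI : artinian I) (slpI : kSLP n I) (Ih : hilbert_function I h).
Let II : is_ideal I := proj1 gI.
Implicit Types (g : 'M[K]_n).

Local Notation prefix k s := (fun m : 'X_{1..n} => low k.+1 m && (m k < s)%N).
Local Notation stdm g := (fun m => ~~ asb (lead (mx_act_ideal g I) m)).

(** In degrees beyond those of the spanning polynomials [b i], the homogeneous part of
    [p - \sum_i c i *: b i] is [p]. This bound reduces the rank conditions to finitely many. *)
Lemma artinian_bound : exists B, forall t p, (B <= t)%N -> p \is t.-homog -> I p.
Proof.
have [d [b bI]] := aI; exists (\max_(i < d) msize (b i)) => t p Bt hp.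
have [c Ic] := bI p; have := proj2 gI _ t Ic.
rewrite pihomogB (pihomog_dE hp) [X in _ - X]linear_sum /= big1 ?subr0 //= => i _.
rewrite linearZ /= (_ : pihomog _ _ _ = 0) ?scaler0 //.
apply/mpolyP => m; rewrite mcoeff_pihomog mcoeff0; case: eqP => // mt.
by apply/memN_msupp_eq0/msize_mdeg_ge; rewrite mt; apply: leq_trans Bt; apply: leq_bigmax.
Qed.

Lemma leq_big_var (u v : 'X_{1..n}) (k : 'I_n) : mdeg v = mdeg u -> revlex_gt v u ->
  low k.+1 u -> low k.+1 v /\ (v k <= u k)%N.
Proof.
move=> evu /revlexP[// |i lt al] /lowP lu.
have ik : (i <= k)%N by rewrite leqNgt; apply/negP => /lu e; rewrite e in lt.
split; first by apply/lowP => j kj; rewrite al ?lu // (leq_ltn_trans ik).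
case: (eqVneq i k) => [<-|ne]; first exact: ltnW.
by rewrite al // ltn_neqAle ik andbT.
Qed.

Lemma revlex_up_prefix t (k : 'I_n) s : revlex_up t (prefix k s).
Proof.
move=> u v ut vt /andP[lu uk] gt.
have [|-> vk] := leq_big_var _ gt lu; first by rewrite ut.
exact: leq_ltn_trans vk uk.
Qed.

Section GoodCoordinates.
Context (B : nat) (bB : forall t p, (B <= t)%N -> p \is t.-homog -> I p).
Context (g : 'M[K]_n) (ug : g \in unitmx).
Hypothesis rank_prefix : forall (k : 'I_n) (s t : 'I_B.+2),
  rank_ge (mx_act_ideal g I) t (prefix k s)
    (cnt t (prefix k s) - hdiff (iter (n - k.+1) Delta h) s t).
Let L := mx_act_ideal g I.
Let gL : graded_ideal L := mx_act_ideal_graded ug gI.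
Let D := stdm g.

Lemma std_down m m' : D (m + m')%MM -> D m.
Proof. by apply: contra => /asbP lm; apply/asbP; apply: lead_upclosed. Qed.

Lemma std_count t : cnt t D = h t.
Proof.
exact: (dim_component_uniq (proj1 gL) (dim_std gL t) (mx_act_dim ug (Ih t))).
Qed.

Lemma std_bound m : (B <= mdeg m)%N -> ~~ D m.
Proof.
move=> Bm; rewrite negbK; apply/asbP; exists 'X_[m].
  apply/mx_act_idealE => //; apply: (bB Bm); apply: mx_act_homog.
  by rewrite dhomogX.
split; first by rewrite msuppX inE.
by move=> m'; rewrite msuppX inE => /eqP ->; rewrite eqxx.
Qed.

Lemma rank_ge_std t (C : pred 'X_{1..n}) N : revlex_up t C -> rank_ge L t C (cnt t C - N) ->
  (cnt t (fun m => C m && D m) <= N)%N.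
Proof.
move=> upC rC; have := rank_ge_lead gL upC rC.
rewrite [in X in (X <= _)%N -> _](cnt_split t C D) addnC.
have -> : cnt t (fun m => C m && ~~ D m) = cnt t (fun m => C m && asb (lead L m)).
  by apply: eq_cnt => m _; rewrite /D negbK.
by clear; lia.
Qed.

(** Degrees above [B] have no standard monomials, and in degree [t <= B] any [s > t] may be replaced
    by [t + 1]; hence indices up to [B + 1] suffice. *)
Lemma std_prefix (k : 'I_n) s t :
  (cnt t (fun m => D m && low k.+1 m && (m k < s)%N)
     <= hdiff (iter (n - k.+1) Delta h) s t)%N.
Proof.
have E s' : cnt t (fun m => D m && low k.+1 m && (m k < s')%N)
    = cnt t (fun m => prefix k s' m && D m).
  by apply: eq_cnt => m _; rewrite -andbA andbC.
case: (ltnP t B.+1) => tB; last first.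
  rewrite [X in (X <= _)%N](_ : _ = 0%N) //; apply/eqP; rewrite -leqn0 leqNgt -has_count.
  apply/hasPn => m; rewrite mem_mons => /eqP mt.
  by rewrite (negbTE (std_bound _)) // mt ltnW.
have bound s' : (s' < B.+2)%N -> (cnt t (fun m => D m && low k.+1 m && (m k < s')%N)
     <= hdiff (iter (n - k.+1) Delta h) s' t)%N.
  move=> sB; rewrite E; apply: rank_ge_std; first exact: revlex_up_prefix.
  exact: (rank_prefix k (Ordinal sB) (Ordinal (ltnW tB : (t < B.+2)%N))).
case: (leqP s t.+1) => st; first by apply: bound; apply: leq_ltn_trans st _.
have -> : hdiff (iter (n - k.+1) Delta h) s t = hdiff (iter (n - k.+1) Delta h) t.+1 t.
  by rewrite /hdiff ltnn leqNgt ltnW.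
apply: leq_trans (bound t.+1 _) => //; apply: leq_cnt => m mt /andP[-> _].
by rewrite ltnS -mt leq_mdeg.
Qed.

Context (i0 i1 i2 : 'I_n).
Hypotheses (e0 : i0 = 0%N :> nat) (e1 : i1 = 1%N :> nat) (e2 : i2 = 2%N :> nat).

(** In degree [T], an initial segment of the revlex order on monomials in [x_0, x_1, x_2], cut off
    after the expected number of leading monomials of slice [s]. *)
Definition shear_set (s T : nat) : pred 'X_{1..n} :=
  fun m => low 3 m && ((m i2 < s)%N || (m i2 == s) && (m i1 < nlead_slice h s T i2)%N).

Lemma revlex_up_shear s T : revlex_up T (shear_set s T).
Proof.
move=> u v ut vt /andP[lu cu] gt; rewrite -e2 in lu.
have [|lv vk] := leq_big_var _ gt lu; first by rewrite ut.
rewrite e2 in lv; apply/andP; split=> //.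
case/orP: cu => [lt|/andP[/eqP us lt]]; first by rewrite (leq_ltn_trans vk).
move: vk; rewrite us leq_eqVlt => /orP[/eqP vs|->] //; apply/orP; right; rewrite vs eqxx /=.
have /revlexP[|i lti al] := gt; first by rewrite ut.
case: (ltngtP i 1) => i1'.
- by rewrite al ?e1.
- suff : i = i2 by move=> ei; move: lti; rewrite ei us vs ltnn.
  apply: val_inj; rewrite /= e2; apply/eqP; rewrite eqn_leq i1' andbT leqNgt; apply/negP => i3.
  by move: lti; rewrite (lowP _ _ lu i) // e2.
have ei : i = i1 by apply: val_inj; rewrite /= e1.
by rewrite -ei in lt *; apply: ltn_trans lti lt.
Qed.

Hypothesis rank_shear : forall s T : 'I_B.+2, rank_ge L T (shear_set s T)
  (cnt T (shear_set s T) - hdiff (iter (n - 3) Delta h) s T).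

(** Exactly [r] monomials of a slice are leading, and [rank_shear] makes them the [r] largest. The
    standard ones are thus those with exponent of [x_1] at least [r], a set stable under trading
    [x_0] for [x_1]. *)
Lemma std_exchange m : low 3 m -> D (m + U_(i0))%MM -> D (m + U_(i1))%MM.
Proof.
move=> lm Dv; apply: contraT => nDu; set u := (m + U_(i1))%MM in nDu.
set v := (m + U_(i0))%MM in Dv; have n1 : (i1 == i0) = false by rewrite -(inj_eq val_inj) /= e0 e1.
have n20 : (i0 == i2) = false by rewrite -(inj_eq val_inj) /= e0 e2.
have n21 : (i1 == i2) = false by rewrite -(inj_eq val_inj) /= e1 e2.
pose s := v i2; pose j := v i1; pose T := mdeg v.
have us : u i2 = s by rewrite /s !mnmDE !mnm1E n20 n21.
have uj : u i1 = j.+1 by rewrite /j !mnmDE !mnm1E eqxx [i0 == _]eq_sym n1 addn1 addn0.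
have uT : mdeg u = T by rewrite /T !mdegD !mdeg1.
have lowU (i : 'I_n) : (i < 3)%N -> low 3 (m + U_(i))%MM.
  move=> i3; apply/lowP => k k3; rewrite mnmDE (lowP _ _ lm) // mnm1E.
  by case: eqP => // ik; move: i3; rewrite ik ltnNge k3.
have lu : low 3 u by apply: lowU; rewrite e1.
have lv : low 3 v by apply: lowU; rewrite e0.
have TB : (T < B)%N by rewrite ltnNge; apply/negP => /std_bound; rewrite Dv.
have sB : (s < B)%N by apply: leq_ltn_trans TB; apply: leq_mdeg.
set r := nlead_slice h s T i2.
have cr : cnt T (fun m => [&& low 3 m, m i2 == s & ~~ D m]) = r.
  exact: (cnt_lead_slice std_down std_count std_prefix s T e2).
have low_r (w : 'X_{1..n}) : mdeg w = T -> low 3 w -> w i2 = s -> (w i1 < r)%N -> ~~ D w.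
  move=> wT lw ws wr; apply/negP => Dw.
  have sB2 : (s < B.+2)%N by apply: ltn_trans sB _; rewrite ltnS.
  have TB2 : (T < B.+2)%N by apply: ltn_trans TB _; rewrite ltnS.
  (* [shear_set] contains at most as many standard monomials as its part with exponent of [x_2]
     below [s], so slice [s] contributes none. *)
  have := rank_ge_std (@revlex_up_shear s T) (rank_shear (Ordinal sB2) (Ordinal TB2)).
  have := cnt_prefix std_down std_count std_prefix i2 s T; rewrite e2 /= => <- le.
  suff : D w && low 3 w && (w i2 < s)%N by rewrite ws ltnn andbF.
  apply: (@cnt_full _ T (fun m => D m && low 3 m && (m i2 < s)%N)
    (fun m => shear_set s T m && D m) _ le w wT).
    by move=> x _ /andP[/andP[Dx lx] xs]; rewrite /shear_set lx xs Dx.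
  by rewrite /shear_set lw ws eqxx wr orbT Dw.
case: (ltnP j r) => jr; first by have := low_r v erefl lv erefl jr; rewrite Dv.
(* Otherwise [u] and the [r] largest monomials of the slice are [r + 1] leading monomials. *)
pose X i := (v - U_(i1) *+ (j - i) + U_(i0) *+ (j - i))%MM.
have Xi1 i : (i <= j)%N -> X i i1 = i.
  move=> ij; rewrite mnmDE mnmBE !mulmnE !mnm1E eqxx [i0 == _]eq_sym n1 mul1n mul0n addn0.
  by rewrite -/j subKn.
have Xi2 i : X i i2 = s by rewrite mnmDE mnmBE !mulmnE !mnm1E n20 n21 subn0 addn0.
have XT i : (i <= j)%N -> mdeg (X i) = T.
  move=> ij; have e : v = (v - U_(i1) *+ (j - i) + U_(i1) *+ (j - i))%MM.
    rewrite submK //; apply/mnm_lepP => k; rewrite mulmnE mnm1E; case: eqP => [<-|_]; last by rewrite mul0n.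
    by rewrite mul1n leq_subr.
  by rewrite /T [in RHS]e !mdegD !mdegMn !mdeg1.
have Xl i : low 3 (X i).
  apply/lowP => k k3; rewrite mnmDE mnmBE (lowP _ _ lv) // sub0n mulmnE mnm1E.
  by case: eqP => // ik; move: k3; rewrite -ik e0.
have : (r.+1 <= r)%N.
  rewrite -{2}cr /cnt -size_filter -{1}(size_iota 0 r) -(size_map X) -[X in (X <= _)%N]/(size (u :: map X (iota 0 r))).
  apply: uniq_leq_size => /=.
    rewrite map_inj_in_uniq ?iota_uniq ?andbT => [|a b].
      apply/mapP => -[i]; rewrite mem_iota add0n => /andP[_ ir] ei.
      by have := Xi1 i (ltnW (leq_trans ir jr)); rewrite -ei uj => e; move: (leq_trans ir jr); rewrite -e ltnNge leqnSn.
    rewrite !mem_iota !add0n => /andP[_ ar] /andP[_ br] /(congr1 (fun x : 'X_{1..n} => x i1)).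
    by rewrite !Xi1 // ltnW // (leq_trans _ jr).
  move=> w; rewrite inE mem_filter_mons => /orP[/eqP ->|/mapP[i]].
    by rewrite lu us eqxx nDu uT eqxx.
  rewrite mem_iota add0n => /andP[_ ir] ->; have ij : (i <= j)%N := ltnW (leq_trans ir jr).
  by rewrite Xl Xi2 XT // !eqxx low_r ?Xi1 ?XT.
by rewrite ltnn.
Qed.

End GoodCoordinates.

End GenericInitialIdeal.

(** * Existence of good coordinates and conclusion *)

Section Main.
Context (n : nat) (K : fieldType) (char0 : [pchar K] =i pred0).
Local Notation R := {mpoly K[n]}.
Implicit Types (g : 'M[K]_n) (I : R -> Prop).

Lemma mx_act_ideal_linear g I : is_ideal I ->
  mx_act_ideal g I 0 /\ forall (a : K) u v, mx_act_ideal g I u -> mx_act_ideal g I v ->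
    mx_act_ideal g I (a *: u + v).
Proof.
move=> II; split; first by exists 0; [apply: (ideal0 II) | rewrite mx_act0].
move=> a _ _ [p Ip ->] [q Iq ->]; exists (a *: p + q); last by rewrite mx_actD mx_actZ.
by apply: (idealD II) => //; apply: (idealZ II).
Qed.

Lemma generic_prefix I h B : graded_ideal I -> kSLP n I -> hilbert_function I h ->
  generic (fun g => forall (k : 'I_n) (s t : 'I_B),
    rank_ge (mx_act_ideal g I) t (fun m => low k.+1 m && (m k < s)%N)
      (cnt t (fun m : 'X_{1..n} => low k.+1 m && (m k < s)%N)
        - hdiff (iter (n - k.+1) Delta h) s t)).
Proof.
move=> gI slpI Ih; have II := proj1 gI; have [G uG GP] := independent_forms gI slpI Ih.
apply: (generic_forall char0) => k; apply: (generic_forall char0) => s.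
apply: (generic_forall char0) => t.
(* [rev_ord k] is [n - k - 1], the number of forms sent to variables after [x_k]. *)
have cd := codim_of_flag II uG (GP (rev_ord k) s t).
set g := trmx _ in cd; have [V0 VL] := mx_act_ideal_linear g II.
exact: (generic_rank_ge (codim_rank V0 VL cd)).
Qed.

(** The shear depends on [s] and [T], but one matrix suffices to make a single rank condition
    generic, and the finitely many generic conditions are then intersected. *)
Lemma generic_shear I h B (i0 i1 i2 : 'I_n) : i0 = 0%N :> nat -> i1 = 1%N :> nat ->
  i2 = 2%N :> nat -> graded_ideal I -> hilbert_function I h ->
  (forall t p, (B <= t)%N -> p \is t.-homog -> I p) ->
  (exists g, g \in unitmx /\ forall (k : 'I_n) (s t : 'I_B.+2),
    rank_ge (mx_act_ideal g I) t (fun m => low k.+1 m && (m k < s)%N)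
      (cnt t (fun m : 'X_{1..n} => low k.+1 m && (m k < s)%N)
        - hdiff (iter (n - k.+1) Delta h) s t)) ->
  generic (fun g => forall s T : 'I_B.+2, rank_ge (mx_act_ideal g I) T (shear_set h i1 i2 s T)
    (cnt T (shear_set h i1 i2 s T) - hdiff (iter (n - 3) Delta h) s T)).
Proof.
move=> e0 e1 e2 gI Ih bB [g [ug rk]]; have II := proj1 gI.
apply: (generic_forall char0) => s; apply: (generic_forall char0) => T.
have gL := mx_act_ideal_graded ug gI.
have down := std_down gI ug; have cD := std_count gI Ih ug.
have pre := std_prefix gI bB ug rk.
have [a] := codim_shear char0 e0 e1 e2 s T gL.
have -> : cnt T (fun m => [&& low 3 m, m i2 == s & asb (lead (mx_act_ideal g I) m)])
    = nlead_slice h s T i2.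
  rewrite -(cnt_lead_slice down cD pre s T e2).
  by apply: eq_cnt => m _; rewrite negbK.
have -> : cnt T (fun m => ~~ asb (lead (mx_act_ideal g I) m) && (low 3 m && (m i2 < s)%N))
    = hdiff (iter (n - 3) Delta h) s T.
  have := cnt_prefix down cD pre i2 s T; rewrite e2 => <-.
  by apply: eq_cnt => m _; rewrite andbA.
have [V0 VL] := mx_act_ideal_linear (shear i0 i1 a) (proj1 gL).
move=> /(codim_rank V0 VL)[f fV ff].
apply: (generic_rank_ge (g0 := shear i0 i1 a *m g)); exists f => // i.
by have [_ [p Ip ->] ->] := fV i; exists p; rewrite ?mx_act_comp.
Qed.

Lemma same_almost_revlex (J J' : R -> Prop) : same_set J J' -> almost_revlex J -> almost_revlex J'.
Proof.
move=> JJ' [[S JS] aJ]; split.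
  by exists S => p; split=> [/JJ'/JS|/JS/JJ'].
move=> u v [J'u minu] evu gt; apply/JJ'; apply: (aJ u) gt => //.
by split; [apply/JJ' | move=> m /JJ'; apply: minu].
Qed.

Lemma generic_almost_revlex I h : graded_ideal I -> artinian I -> kSLP n I ->
  hilbert_function I h ->
  (forall k : nat, (k + 4 <= n)%N -> quasi_symmetric (iter k Delta h)) ->
  exists2 U, zariski_open_GL U & (exists g, U g) /\ forall g, U g ->
    almost_revlex (initial_ideal (mx_act_ideal g I)) /\
    hilbert_function (initial_ideal (mx_act_ideal g I)) h.
Proof.
move=> gI aI slpI Ih quasi; have [B bB] := artinian_bound gI aI.
have gen1 := generic_prefix B.+2 gI slpI Ih.
(* The shear argument starts from coordinates in which the slice counts are already the expected
   ones. *)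
have [g0 [u0 rk0]] := generic_ex (genericI char0 (generic_unit n K) gen1).
(* Quantifying over the three indices makes the condition vacuous for [n < 3]. *)
have gen2 : generic (fun g => forall i0 i1 i2 : 'I_n, i0 = 0%N :> nat -> i1 = 1%N :> nat ->
    i2 = 2%N :> nat -> forall s T : 'I_B.+2,
    rank_ge (mx_act_ideal g I) T (shear_set h i1 i2 s T)
      (cnt T (shear_set h i1 i2 s T) - hdiff (iter (n - 3) Delta h) s T)).
  apply: (generic_forall char0) => i0; apply: (generic_forall char0) => i1.
  apply: (generic_forall char0) => i2.
  case: (eqVneq (i0 : nat) 0%N) => [e0|ne]; last first.
    by apply: genericW (genericT n K) => g _ e0; rewrite e0 in ne.
  case: (eqVneq (i1 : nat) 1%N) => [e1|ne]; last first.
    by apply: genericW (genericT n K) => g _ _ e1; rewrite e1 in ne.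
  case: (eqVneq (i2 : nat) 2%N) => [e2|ne]; last first.
    by apply: genericW (genericT n K) => g _ _ _ e2; rewrite e2 in ne.
  apply: genericW (generic_shear e0 e1 e2 gI Ih bB (ex_intro _ g0 (conj u0 rk0))).
  by move=> g.
have [U oU [eU UP]] := generic_open char0
  (genericI char0 (generic_unit n K) (genericI char0 gen1 gen2)).
exists U => //; split=> // g /UP[ug [rk sh]].
have gL := mx_act_ideal_graded ug gI; have iniE := initial_idealE gL.
have upL := lead_upclosed gL.
have cD := std_count gI Ih ug; split; last first.
  move=> t; apply: eq_dim_component (same_set_sym iniE) _.
  by rewrite -cD; apply: dim_supp_in.
split.
  by exists (lead (mx_act_ideal g I)) => p; split=> [/iniE/(monomial_genE upL)|/(monomial_genE upL)/iniE].
have iniX m : initial_ideal (mx_act_ideal g I) 'X_[m] <-> lead (mx_act_ideal g I) m.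
  by split=> [/iniE/supp_inX|lm]; last by apply/iniE/supp_inX.
move=> u v [/iniX lu minu] evu gt; apply/iniX; apply/asbP; rewrite -[asb _]negbK.
apply: (std_almost_revlex (std_down gI ug) cD (std_prefix gI bB ug rk) quasi _ _ _ evu gt).
- move=> i0 i1 e0 e1 n3 m lm; have e2 : (Ordinal n3 : nat) = 2%N by [].
  by apply: (std_exchange gI Ih bB ug rk e0 e1 e2 (sh i0 i1 (Ordinal n3) e0 e1 e2)) => //.
- by rewrite negbK; apply/asbP.
by move=> m mu ne; apply/asbP => lm; move/eqP: ne; apply; apply: minu => //; apply/iniX.
Qed.

End Main.

Local Close Scope ring_scope.

Theorem theorem39 (n : nat) (K : fieldType) (I : {mpoly K[n]} -> Prop) (h : nat -> nat) :
  [pchar K]%R =i pred0 ->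
  graded_ideal I -> artinian I -> kSLP n I -> hilbert_function I h ->
  (forall k : nat, k + 4 <= n -> quasi_symmetric (iter k Delta h)) ->
  [/\ almost_revlex (gin I),
      hilbert_function (gin I) h,
      (forall J : {mpoly K[n]} -> Prop,
         almost_revlex J -> hilbert_function J h -> same_set J (gin I))
    & (forall I' : {mpoly K[n]} -> Prop,
         graded_ideal I' -> artinian I' -> kSLP n I' -> hilbert_function I' h ->
         same_set (gin I') (gin I))].
Proof.
move=> char0 gI aI slpI Ih quasi.
(* Stated for every ideal with Hilbert function [h], since the last claim compares two of them. *)
have ginP (I' : {mpoly K[n]} -> Prop) : graded_ideal I' -> artinian I' -> kSLP n I' ->
    hilbert_function I' h -> almost_revlex (gin I') /\ hilbert_function (gin I') h.
  move=> gI' aI' slpI' Ih'.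
  have [U oU [eU UP]] := generic_almost_revlex char0 gI' aI' slpI' Ih' quasi.
  have cst g g' : U g -> U g' ->
      same_set (initial_ideal (mx_act_ideal g I')) (initial_ideal (mx_act_ideal g' I')).
    by move=> /UP[ar hf] /UP[ar' hf']; apply: almost_revlex_uniq ar ar' hf hf'.
  have [g Ug] := eU; have [ar hf] := UP g Ug.
  have E : same_set (initial_ideal (mx_act_ideal g I')) (gin I').
    (* Membership in [gin] may be witnessed by any open set [V]; it meets [U], and on [U] the
       initial ideal is constant by uniqueness. *)
    move=> p; split=> [ip|[V [oV eV cV] Vp]].
      by exists U => [|g' Ug']; [split | apply/(cst g' g Ug' Ug)].
    have [g' [Ug' Vg']] := open_meet char0 oU oV eU eV.
    by apply/(cst g g' Ug Ug'); apply: Vp.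
  split; first exact: same_almost_revlex E ar.
  by move=> t; apply: eq_dim_component E (hf t).
have [ar hf] := ginP I gI aI slpI Ih; split=> // [J arJ hJ|I' gI' aI' slpI' Ih'].
  exact: almost_revlex_uniq arJ ar hJ hf.
have [ar' hf'] := ginP I' gI' aI' slpI' Ih'.
exact: almost_revlex_uniq ar' ar hf' hf.
Qed.
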